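(* Let $P$ be a stationary and ergodic probability measure on environments $\Omega=(0,1)^{\mathbb{Z}}$ satisfying conditions (A1)--(A4) listed in the context, let $X=\{X_n\}_{n\ge 0}$ be the random walk in random environment with annealed law $\mathbb{P}$, and let $\kappa=\min_{y>0} J(y)/y$, where $J$ is the rate function in (A2). Then, under $\mathbb{P}$, as $n\to\infty$: if $\alpha<\kappa$, then $n^{-\alpha}X_n\to\infty$ in probability; if $\alpha>\kappa$, then $n^{-\alpha}X_n\to 0$ in probability.
   Context: Environments. $\Omega=(0,1)^{\mathbb{Z}}$ with its Borel $\sigma$-algebra $\mathcal{F}$; $P$ is a stationary and ergodic probability measure on $(\Omega,\mathcal{F})$ with expectation $E_P$; $\omega=\{\omega_i\}_{i\in\mathbb{Z}}\in\Omega$ is the environment, and $\rho_n=(1-\omega_n)/\omega_n$. Random walk. Given $\omega$, the quenched law $P_\omega$ makes $X=\{X_n\}_{n\ge 0}$ a time-homogeneous Markov chain on $\mathbb{Z}$ with $P_\omega(X_0=0)=1$, $P_\omega(X_{n+1}=i+1\mid X_n=i)=\omega_i$ and $P_\omega(X_{n+1}=i-1\mid X_n=i)=1-\omega_i$. The annealed law is $\mathbb{P}(F\times G)=\int_F P_\omega(G)\,P(d\omega)$ for $F\in\mathcal{F}$ and $G$ in the cylinder $\sigma$-algebra on path space. Conditions on the environment. (A1) The series $\sum_{n=1}^\infty n^\xi\,\eta(n)$ converges for every $\xi>0$, where $\eta(n)=\sup\{|P(A\cap B)-P(A)P(B)|: A\in\sigma(\omega_i:i\le 0),\ B\in\sigma(\omega_i:i\ge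 n)\}$. (A2) The sequence $\overline{V}_n=n^{-1}\sum_{i=0}^{n-1}\log\rho_i$ satisfies the Large Deviation Principle with a good rate function $J:\mathbb{R}\to[0,\infty]$: the level sets $J^{-1}([0,a])$ are compact for every $a>0$, and for every Borel set $A\subset\mathbb{R}$, $-\inf_{x\in A^{o}}J(x)\le\liminf_{n\to\infty}\frac1n\log P(\overline{V}_n\in A)\le\limsup_{n\to\infty}\frac1n\log P(\overline{V}_n\in A)\le-\inf_{x\in\mathrm{cl}(A)}J(x)$, where $A^o$ is the interior and $\mathrm{cl}(A)$ the closure of $A$. (A3) $\limsup_{n\to\infty}\frac1n\log E_P\bigl(\prod_{i=0}^{n-1}\rho_i^\lambda\bigr)<\infty$ for all $\lambda\in\mathbb{R}$. (A4) $\limsup_{n\to\infty}\frac1n\log E_P\bigl(\prod_{i=0}^{n-1}\rho_i\bigr)\ge 0$, and $\limsup_{n\to\infty}\frac1n\log E_P\bigl(\prod_{i=0}^{n-1}\rho_i^{\lambda_1}\bigr)<0$ for some $\lambda_1>0$. Convergence of random variables $Y_n$ to $\infty$ in probability means $\mathbb{P}(Y_n>M)\to1$ for every $M\in\mathbb{R}$. *)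

(* Defs.v *)
From HB Require Import structures.
From mathcomp Require Import all_boot all_order all_algebra.
From mathcomp Require Import all_classical all_reals all_analysis.
Import Order.TTheory GRing.Theory Num.Theory.
Import numFieldNormedType.Exports.

Set Implicit Arguments.
Unset Strict Implicit.
Unset Printing Implicit Defensive.

Local Open Scope classical_set_scope.
Local Open Scope ring_scope.

Section environments.
Context (R : realType).

(* (0,1)^Z with the product topology (each factor [set_type] carries the subspace
   topology inherited from [R]), then with the corresponding Borel sigma-algebra. *)
Definition env_space :=
  prod_topology (fun _ : int => set_type (`]0, 1[%classic : set R)).

HB.instance Definition _ := Topological.on env_space.

Lemma half_in_unit_itv : (2^-1 : R) \in (`]0, 1[%classic : set R).
Proof.
by apply/mem_set; rewrite /= in_itv /= invr_gt0 ltr0n invf_lt1 ?ltr1n ?ltr0n.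
Qed.

HB.instance Definition _ := isPointed.Build env_space
  (fun=> SigSub half_in_unit_itv : set_type _).

Definition env := g_sigma_algebraType (@open env_space).

Definition omega (w : env) (i : int) : R := set_val (w i).

Definition rho (w : env) (i : int) : R := (1 - omega w i) / omega w i.

Definition env_shift (w : env) : env := fun i => w (i + 1).

Definition stationary (P : probability env R) :=
  forall A : set env, measurable A -> P (env_shift @^-1` A) = P A.

Definition ergodic (P : probability env R) :=
  forall A : set env, measurable A -> env_shift @^-1` A = A ->
    P A = 0%E \/ P A = 1%E.

(* sigma(omega_i : i in I) *)
Definition sigma_coord (I : set int) : set (set env) :=
  <<s \bigcup_(i in I)
        preimage_set_system setT (fun w : env => omega w i) measurable >>.

Definition mixing_coef (P : probability env R) (n : nat) : R :=
  sup [set r | exists A B : set env,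
    [/\ sigma_coord [set i | i <= 0] A,
        sigma_coord [set i | n%:Z <= i] B &
        r = `|fine (P (A `&` B)) - fine (P A) * fine (P B)|]].

Definition condA1 (P : probability env R) :=
  forall xi : R, 0 < xi ->
    cvgn (fun n => \sum_(1 <= k < n) k%:R `^ xi * mixing_coef P k).

Definition mean_log_rho (n : nat) (w : env) : R :=
  n%:R^-1 * \sum_(0 <= i < n) ln (rho w i%:Z).

Local Open Scope ereal_scope.

(* [lne] is the extended logarithm: [lne 0 = -oo]. *)
Definition LDP (P : probability env R) (V : nat -> env -> R) (J : R -> \bar R) :=
  [/\ forall x, 0 <= J x,
      forall a : R, (0 < a)%R -> compact [set x | J x <= a%:E],
      forall A : set R, measurable A ->
        - ereal_inf [set J x | x in A°] <=
          limn_einf (fun n => n%:R^-1%:E * lne (P (V n @^-1` A))) &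
      forall A : set R, measurable A ->
        limn_esup (fun n => n%:R^-1%:E * lne (P (V n @^-1` A))) <=
          - ereal_inf [set J x | x in closure A]].

Definition condA2 (P : probability env R) (J : R -> \bar R) :=
  LDP P mean_log_rho J.

Definition log_moment_growth (P : probability env R) (lambda : R) : \bar R :=
  limn_esup (fun n =>
    n%:R^-1%:E * lne 'E_P[fun w => (\prod_(0 <= i < n) rho w i%:Z `^ lambda)%R]).

Definition condA3 (P : probability env R) :=
  forall lambda : R, log_moment_growth P lambda < +oo.

(* [log_moment_growth P 1] is the growth rate of E_P(prod_i rho_i). *)
Definition condA4 (P : probability env R) :=
  0 <= log_moment_growth P 1 /\
  exists2 lambda1 : R, (0 < lambda1)%R & log_moment_growth P lambda1 < 0.

Definition rate_ratio (J : R -> \bar R) (y : R) : \bar R := J y * y^-1%:E.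

(* An infimum; that it is attained has to be asserted separately. *)
Definition kappa (J : R -> \bar R) : \bar R :=
  ereal_inf [set rate_ratio J y | y in [set y | (0 < y)%R]].

End environments.

Section walk.
Context (R : realType).

Definition trajectory := nat -> int.

HB.instance Definition _ := Choice.on trajectory.
HB.instance Definition _ := isPointed.Build trajectory (fun=> 0).

Definition cylinder (n : nat) (x : trajectory) : set trajectory :=
  [set X | forall k, (k <= n)%N -> X k = x k].

(* Trajectories with the cylinder sigma-algebra. *)
Definition path_space :=
  g_sigma_algebraType [set C | exists n x, C = cylinder n x].

Local Open Scope ereal_scope.

Definition cond_prob d (T : measurableType d) (Q : probability T R)
  (A B : set T) : \bar R := Q (A `&` B) / Q B.

(* Markov property, then transition probabilities; conditional probabilities are
   constrained only given events of nonzero probability.  Together with the initial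
   condition this determines [Q] on cylinders, hence everywhere. *)
Definition is_quenched_law (w : env R) (Q : probability path_space R) :=
  [/\ Q [set X | X 0%N = 0%R] = 1,
      forall n (x : trajectory) (j : int), Q (cylinder n x) != 0 ->
        cond_prob Q [set X | X n.+1 = j] (cylinder n x) =
        cond_prob Q [set X | X n.+1 = j] [set X | X n = x n] &
      forall n (i : int), Q [set X | X n = i] != 0 ->
        cond_prob Q [set X | X n.+1 = (i + 1)%R] [set X | X n = i] =
          (omega w i)%:E /\
        cond_prob Q [set X | X n.+1 = (i - 1)%R] [set X | X n = i] =
          (1 - omega w i)%:E].

Definition is_annealed_law (P : probability (env R) R)
    (Pq : env R -> probability path_space R)
    (PP : probability (env R * path_space)%type R) :=
  forall (F : set (env R)) (G : set path_space), measurable F -> measurable G ->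
    PP (F `*` G) = \int[P]_(w in F) Pq w G.

Definition cvg_prob_pinfty d (T : measurableType d) (Q : probability T R)
    (Y : nat -> T -> R) :=
  forall M : R, Q [set t | (M < Y n t)%R] @[n --> \oo] --> 1.

Definition cvg_prob0 d (T : measurableType d) (Q : probability T R)
    (Y : nat -> T -> R) :=
  forall e : R, (0 < e)%R -> Q [set t | (e < `|Y n t|)%R] @[n --> \oo] --> 0.

Definition scaled_walk (alpha : R) (n : nat) (z : env R * path_space) : R :=
  (n%:R `^ (- alpha) * (z.2 n)%:~R)%R.

End walk.

(* Main.v *)
Require Import Defs.
From HB Require Import structures.
From mathcomp Require Import all_boot all_order all_algebra.
From mathcomp Require Import all_classical all_reals all_analysis.
From mathcomp Require Import measurable_realfun.
From mathcomp Require Import ring lra zify.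
Import Order.TTheory GRing.Theory Num.Theory.
Import numFieldNormedType.Exports.

(** A stretch of [l] sites on which the [ln rho] add up to at least [c] is a
trap: the walk crosses it to the right about once in [exp c] attempts.  By the
large deviation principle a stretch with [c = y * l] has probability about
[exp (- l * J y)], so that the first [m] sites contain traps of depth up to
[ln m / kappa], the minimum of [J y / y] being the cheapest price of a unit of
depth.  Covering the distance [m] thus takes a time of order
[m ^ (1 / kappa)], which is the theorem.

Hitting times are avoided: both limits only concern the law of [X_n] at one
time, and [quenched_marginal_le] bounds [P_w (X_n in S)] by the [n]-th iterate
of the one-step operator [step] on the indicator of [S].  A function that lies
above this indicator and does not increase much under [step] therefore bounds
the probability.  All such functions come from the scale function of the walk,
which is harmonic:
- [quenched_trap_bound] clips it between both ends of a trap of depth [c]; a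
  step increases the result by at most [exp (- c)], hence such a trap between
  [0] and [m] gives [P_w (X_n > m) <= n * exp (- c)];
- [quenched_left_bound] uses it as it is, against large negative values;
- [quenched_slow_bound] truncates it at [1].  The iterates of the result
  decrease in time, so the last one is at most their average, which is
  controlled by the expected time spent to the left of [2 * m] plus the
  probability to return from [2 * m] to [m].

If [alpha > kappa], the mixing condition makes separated stretches almost
independent, and [quiet_blocks_le] shows that one of the many stretches in
[0, n ^ alpha] is, with high probability, a trap of depth more than [ln n].

If [alpha < kappa], choose [lam > 0] between [alpha] and [kappa].  As
[J x >= lam * x + c0] for some [c0 > 0] ([rate_ge_affine_kappa]), the upper
large deviation bound gives exponential decay of [E (prod rho ^ lam)]
([moment_decay]).  As [lam <= 1], the power [lam] is subadditive, and the
moments of order [lam] of the sums in [quenched_slow_bound] are sums of such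
expectations; [annealed_slow_bound] is then of order
[m * n ^ (- lam) + r ^ m] with [r < 1].

The facts on [kappa] follow from affine lower bounds of [J], which the lower
large deviation bound derives from exponential moments ([rate_ge_affine]): the
bound with positive constant term given by the negative moment rate forces
[kappa > 0] and keeps minimizers away from [0], one of slope [3] keeps them
bounded, and [kappa > 1] would make the growth rate of [E (prod rho)]
negative. *)

Local Open Scope classical_set_scope.
Local Open Scope ring_scope.

(** * The one-step operator of the walk in a fixed environment *)

Section quenched_operator.
Context {R : realType} (w : env R).

Lemma omega_gt0 i : 0 < omega w i.
Proof.
by have := set_valP (w i); rewrite /= in_itv /= /omega => /andP[].
Qed.

Lemma omega_lt1 i : omega w i < 1.
Proof.
by have := set_valP (w i); rewrite /= in_itv /= /omega => /andP[].
Qed.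

Lemma rho_gt0 i : 0 < rho w i.
Proof. by rewrite /rho divr_gt0 ?subr_gt0 ?omega_lt1 ?omega_gt0. Qed.

Lemma omega_rho i : omega w i * rho w i = 1 - omega w i.
Proof. by rewrite /rho mulrC divfK // gt_eqF ?omega_gt0. Qed.

Lemma omega_1rho i : omega w i * (1 + rho w i) = 1.
Proof. by rewrite mulrDr omega_rho mulr1 addrC subrK. Qed.

Definition step (f : int -> R) (x : int) : R :=
  omega w x * f (x + 1) + (1 - omega w x) * f (x - 1).

Lemma step_le f g x : f (x + 1) <= g (x + 1) -> f (x - 1) <= g (x - 1) ->
  step f x <= step g x.
Proof.
move=> h1 h2; rewrite /step lerD // ler_wpM2l //.
  exact/ltW/omega_gt0.
by rewrite subr_ge0 ltW ?omega_lt1.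
Qed.

Lemma step_cst c x : step (fun=> c) x = c.
Proof. by rewrite /step; ring. Qed.

(** The walk moves by one site per step, so [n] iterations at [x] only see the
values within distance [n]: bounds on that window suffice. *)
Lemma iter_step_le n f g x :
  (forall y, `|y - x| <= n%:Z -> f y <= g y) ->
  iter n step f x <= iter n step g x.
Proof.
elim: n x => [|n ih] x fg /=; first by apply: fg; lia.
by apply: step_le; apply: ih => y hy; apply: fg; lia.
Qed.

Lemma stepD f g : step (f \+ g) = step f \+ step g.
Proof. by apply/funext => x; rewrite /step /=; ring. Qed.

Lemma stepZ c f : step (fun x => c * f x) = (fun x => c * step f x).
Proof. by apply/funext => x; rewrite /step /=; ring. Qed.

Lemma iter_stepD n f g : iter n step (f \+ g) = iter n step f \+ iter n step g.
Proof. by elim: n => //= n ->; rewrite stepD. Qed.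

Lemma iter_stepZ n c f :
  iter n step (fun x => c * f x) = (fun x => c * iter n step f x).
Proof. by elim: n => //= n ->; rewrite stepZ. Qed.

Lemma iter_step_cst n c : iter n step (fun=> c) = (fun=> c).
Proof. by elim: n => //= n ->; apply/funext => x; rewrite step_cst. Qed.

Lemma iter_step_telescope k g c x :
  iter k step (fun y => g y - step g y + c) x =
  iter k step g x - iter k.+1 step g x + c.
Proof.
have -> : (fun y => g y - step g y + c) =
    (g \+ (fun y => -1 * step g y)) \+ (fun=> c).
  by apply/funext => y /=; rewrite mulN1r.
by rewrite !iter_stepD iter_stepZ iter_step_cst iterSr /= mulN1r.
Qed.

Lemma iter_step_supersolution n h c x :
  (forall y, step h y <= h y + c) -> iter n step h x <= h x + n%:R * c.
Proof.
move=> hc; elim: n x => [|n ih] x; first by rewrite mul0r addr0.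
rewrite iterS; apply: (@le_trans _ _ (step (fun y => h y + n%:R * c) x)).
  by apply: step_le; exact: ih.
have -> : step (fun y => h y + n%:R * c) x = step h x + n%:R * c.
  by rewrite /step; ring.
by have := hc x; rewrite -natr1; lra.
Qed.

Lemma step_minr1 q x : step (fun y => Num.min 1 (q y)) x <= Num.min 1 (step q x).
Proof.
rewrite le_min; apply/andP; split.
  by rewrite -[leRHS](step_cst 1 x); apply: step_le; rewrite ge_min lexx.
by apply: step_le; rewrite ge_min lexx orbT.
Qed.

End quenched_operator.

(** * The potential and the scale function *)

(** Summation over the integers from a fixed origin, with the sign that makes
[primitive v (x + 1) - primitive v x = v x] hold on both sides of it; sums over
integer intervals then become differences. *)
Section primitive.
Context {R : zmodType} (v : int -> R).

Definition primitive (x : int) : R :=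
  match x with
  | Posz n => \sum_(k < n) v k%:Z
  | Negz n => - \sum_(k < n.+1) v (- k.+1%:Z)
  end.

Lemma primitive1 x : primitive (x + 1) = primitive x + v x.
Proof.
case: x => [n|[|n]].
- by rewrite -PoszD addn1 /= big_ord_recr.
- by rewrite NegzE /= big_ord0 big_ord_recr big_ord0 /= add0r addNr.
- have -> : Negz n.+1 + 1 = Negz n by lia.
  by rewrite /= [in RHS]big_ord_recr /= opprD NegzE addrNK.
Qed.

Lemma primitiveD x n :
  primitive (x + n%:Z) = primitive x + \sum_(k < n) v (x + k%:Z).
Proof.
elim: n => [|n ih]; first by rewrite big_ord0 !addr0.
by rewrite -addn1 PoszD addrA primitive1 ih addn1 big_ord_recr /= addrA.
Qed.

End primitive.

Section potential.
Context {R : realType} (w : env R).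

Definition prodrho (i : int) (n : nat) : R := \prod_(0 <= k < n) rho w (i + k%:Z).

Lemma prodrho_gt0 i n : 0 < prodrho i n.
Proof. by apply: prodr_gt0 => k _; exact: rho_gt0. Qed.

Lemma prodrhoSl i n : prodrho i n.+1 = rho w i * prodrho (i + 1) n.
Proof.
rewrite /prodrho big_nat_recl // addr0; congr (_ * _).
by apply: eq_bigr => k _; rewrite -addrA -PoszD add1n.
Qed.

(** The exponential of the potential, normalized by [weight 0 = 1]: the ratio of
two values is the product of the [rho] over the sites between them. *)
Definition weight (x : int) : R := expR (primitive (fun i => ln (rho w (i + 1))) x).

Lemma weight_gt0 x : 0 < weight x.
Proof. exact: expR_gt0. Qed.

Lemma weight1 x : weight (x + 1) = rho w (x + 1) * weight x.
Proof.
by rewrite /weight primitive1 expRD [X in _ * X]lnK ?posrE ?rho_gt0 // mulrC.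
Qed.

Lemma weightE x : weight x = rho w x * weight (x - 1).
Proof. by rewrite -{1 2}[x](subrK 1) weight1. Qed.

Lemma weightD x n : weight (x + n%:Z) = weight x * prodrho (x + 1) n.
Proof.
elim: n x => [|n ih] x; first by rewrite addr0 /prodrho big_nil mulr1.
have -> : x + n.+1%:Z = (x + 1) + n%:Z by lia.
by rewrite ih prodrhoSl weight1; ring.
Qed.

(** The increments [weight x] satisfy [weight x = rho x * weight (x - 1)], which
is exactly what makes their primitive harmonic for [step]. *)
Definition scale := primitive weight.

Lemma step_primitive d x :
  step w (primitive d) x =
  primitive d x + (omega w x * d x - (1 - omega w x) * d (x - 1)).
Proof.
rewrite /step primitive1.
have -> : primitive d (x - 1) = primitive d x - d (x - 1).
  by rewrite -{2}[x](subrK 1) primitive1 addrK.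
ring.
Qed.

Lemma step_scale x : step w scale x = scale x.
Proof.
by rewrite step_primitive [in X in X - _]weightE mulrA omega_rho subrr addr0.
Qed.

Lemma step_affine_scale a b x :
  step w (fun y => a + b * scale y) x = a + b * scale x.
Proof.
by have := step_scale x; rewrite /step => h; rewrite -[in RHS]h; ring.
Qed.

Lemma scale_le x y : x <= y -> scale x <= scale y.
Proof.
move=> xy; have -> : y = x + `|y - x|%N%:Z by lia.
rewrite /scale primitiveD lerDl sumr_ge0 // => k _; exact/ltW/weight_gt0.
Qed.

Lemma scale_gap x : scale (x + 1) - scale x = weight x.
Proof. by rewrite /scale primitive1 addrAC subrr add0r. Qed.

End potential.
(** * Quenched bounds from harmonic functions *)

Section quenched_bounds.
Context {R : realType} (w : env R).

(** The decreasing harmonic function that vanishes at [K] and decreases by [1]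
between [a] and [a + 1].  It dominates the indicator of the half-line left of
[a]: up to a factor it is the probability to reach [a] before [K]. *)
Definition backtrack (a K x : int) : R := (scale w K - scale w x) / weight w a.

Lemma step_backtrack a K x : step w (backtrack a K) x = backtrack a K x.
Proof.
have -> : backtrack a K =
    (fun y => scale w K / weight w a + (- (weight w a)^-1) * scale w y).
  by apply/funext => y; rewrite /backtrack; ring.
by rewrite step_affine_scale.
Qed.

Lemma backtrack_ge0 a K x : x <= K -> 0 <= backtrack a K x.
Proof. by move=> xK; rewrite divr_ge0 ?subr_ge0 ?scale_le // ltW ?weight_gt0. Qed.

Lemma backtrack_anti a K x y : x <= y -> backtrack a K y <= backtrack a K x.
Proof.
by move=> xy; rewrite ler_pM2r ?invr_gt0 ?weight_gt0 // lerD2l lerN2 scale_le.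
Qed.

Lemma backtrack_ge1 a K x : x <= a -> a < K -> 1 <= backtrack a K x.
Proof.
move=> xa aK; rewrite /backtrack ler_pdivlMr ?weight_gt0 // mul1r -scale_gap.
by rewrite lerB ?scale_le // lezD1.
Qed.

Lemma backtrack_sum a (s N : nat) :
  backtrack a (a + s%:Z + N%:Z) (a + s%:Z) =
  \sum_(k < N) prodrho w (a + 1) (s + k).
Proof.
rewrite /backtrack /scale primitiveD addrAC subrr add0r mulr_suml.
apply: eq_bigr => k _; rewrite -addrA -PoszD weightD mulrAC divff ?mul1r //.
by rewrite gt_eqF ?weight_gt0.
Qed.

Lemma quenched_left_bound (s n : nat) :
  iter n (step w) (fun x => (x <= - s%:Z)%R%:R) 0 <=
  \sum_(k < n.+1) prodrho w (- s%:Z + 1) (s + k).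
Proof.
rewrite -backtrack_sum addNr add0r.
apply: (@le_trans _ _ (iter n (step w) (backtrack (- s%:Z) n.+1) 0)).
  apply: iter_step_le => y hy; case: (leP y (- s%:Z)) => ys.
    by apply: backtrack_ge1 => //; lia.
  by apply: backtrack_ge0; lia.
apply: le_trans (iter_step_supersolution w n _ 0 0 _) _.
  by move=> y; rewrite step_backtrack addr0.
by rewrite mulr0 addr0.
Qed.

(** Chosen so that the net flow of [flux] out of [x] is the indicator of
[x < b]; see [flux_rec]. *)
Definition source (b i : int) : R := (i < b)%R%:R * (1 + rho w i) / weight w i.

(** The sum of the fluxes from [x] on is a function whose expected decrease in
one step of the walk is [1] to the left of [b] and [0] elsewhere: an expected
time spent to the left of [b].  The sources start at [- n], below which the walk
does not go in [n] steps. *)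
Definition flux (b : int) (n : nat) (x : int) : R :=
  weight w x * (primitive (source b) (x + 1) - primitive (source b) (- n%:Z)).

Lemma source_ge0 b i : 0 <= source b i.
Proof.
rewrite /source divr_ge0 ?mulr_ge0 //; last exact/ltW/weight_gt0.
by rewrite addr_ge0 // ltW ?rho_gt0.
Qed.

Lemma flux_ge0 b n x : - n%:Z <= x -> 0 <= flux b n x.
Proof.
move=> nx; rewrite mulr_ge0 //; first exact/ltW/weight_gt0.
have -> : x + 1 = - n%:Z + (absz (x + 1 + n%:Z))%:Z by lia.
rewrite primitiveD addrAC subrr add0r sumr_ge0 // => k _; exact: source_ge0.
Qed.

Lemma flux_rec b n x :
  omega w x * flux b n x - (1 - omega w x) * flux b n (x - 1) = (x < b)%R%:R.
Proof.
rewrite /flux subrK primitive1 -omega_rho.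
have wx := weightE w x.
have -> : omega w x * rho w x * (weight w (x - 1) *
  (primitive (source b) x - primitive (source b) (- n%:Z))) = omega w x *
  (weight w x * (primitive (source b) x - primitive (source b) (- n%:Z))).
  by rewrite [in RHS]wx; ring.
have := omega_1rho w x; rewrite /source => o1.
have w0 : weight w x != 0 by rewrite gt_eqF ?weight_gt0.
transitivity ((x < b)%R%:R * (omega w x * (1 + rho w x))); last by rewrite o1 mulr1.
by field.
Qed.

Lemma flux_nat b n (j : nat) : flux b n j =
  \sum_(k < (n + j).+1) (k%:Z - n%:Z < b)%R%:R * (1 + rho w (k%:Z - n%:Z)) *
    (weight w j / weight w (k%:Z - n%:Z)).
Proof.
rewrite /flux; have -> : j%:Z + 1 = - n%:Z + (n + j).+1%:Z by lia.
rewrite primitiveD addrAC subrr add0r mulr_sumr; apply: eq_bigr => k _.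
by rewrite addrC /source; ring.
Qed.

(** The truncation [h] of the backtracking function at [1] is superharmonic, so
its iterates at [0] decrease and the [n]-th one is at most the average of the
first [n].  Each of these is estimated by [1] to the left of [2 * m], where the
sum of the fluxes decreases by [1] per step, and by the value at [2 * m]
elsewhere. *)
Lemma quenched_slow_bound (m n : nat) :
  n%:R * iter n (step w) (fun x => (x <= m%:Z)%R%:R) 0 <=
  \sum_(j < n.+1) flux (m + m)%N n j +
  n%:R * \sum_(k < n.+1) prodrho w (m%:Z + 1) (m + k).
Proof.
rewrite -backtrack_sum; set K := m%:Z + m%:Z + n.+1%:Z.
set b := (m + m)%N%:Z.
pose h x := Num.min 1 (backtrack m K x).
pose g x := primitive (flux b n) n.+1 - primitive (flux b n) x.
have hS x : step w h x <= h x.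
  by apply: le_trans (step_minr1 w _ x) _; rewrite step_backtrack.
have gS x : step w g x = g x - (x < b)%R%:R.
  rewrite -(flux_rec b n x); have := step_primitive w (flux b n) x.
  by rewrite /step /g => e; lra.
have g0 x : `|x - 0| <= n%:Z -> 0 <= g x.
  move=> xn; rewrite /g; have -> : n.+1%:Z = x + (absz (n.+1%:Z - x))%:Z by lia.
  rewrite primitiveD addrAC subrr add0r sumr_ge0 // => k _.
  by apply: flux_ge0; lia.
have hg x : `|x - 0| <= n%:Z -> h x <= g x - step w g x + backtrack m K b.
  move=> xn; rewrite gS subKr /h.
  case: (ltP x b) => xb.
    rewrite ge_min /= mulr1n lerDl backtrack_ge0 // /K /b; lia.
  by rewrite add0r ge_min; apply/orP; right; exact: backtrack_anti.
have decr k : iter k.+1 (step w) h 0 <= iter k (step w) h 0.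
  by rewrite iterSr; apply: iter_step_le => y _; exact: hS.
have decr' k : (k <= n)%N -> iter n (step w) h 0 <= iter k (step w) h 0.
  move=> kn; rewrite -(subnK kn); elim: (n - k)%N => // i ih.
  by rewrite addSn; apply: le_trans ih; exact: decr.
have bnd k : (k <= n)%N -> k%:R * iter n (step w) h 0 <=
    g 0 - iter k (step w) g 0 + k%:R * backtrack m K b.
  elim: k => [|k ih] kn; first by rewrite !mul0r subrr addr0.
  rewrite -natr1 !mulrDl !mul1r.
  have step1 : iter k (step w) h 0 <= iter k (step w) g 0 -
      iter k.+1 (step w) g 0 + backtrack m K b.
    rewrite -(iter_step_telescope w k g).
    by apply: iter_step_le => y hy; apply: hg; lia.

  have := ih (ltnW kn); have := decr' k (ltnW kn); lra.
have -> : m%:Z + m%:Z = b by rewrite /b PoszD.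
have gn : 0 <= iter n (step w) g 0.
  rewrite -[leLHS](_ : iter n (step w) (fun=> 0) 0 = 0).
    exact: iter_step_le.
  by rewrite iter_step_cst.
have g00 : g 0 = \sum_(j < n.+1) flux b n j.
  rewrite /g -[n.+1%:Z]add0r primitiveD addrAC subrr add0r.
  by apply: eq_bigr => j _; rewrite add0r.
rewrite -g00; apply: le_trans (le_trans (bnd n (leqnn n)) _); last by lra.
rewrite ler_wpM2l //; apply: iter_step_le => y hy; rewrite le_min.
case: (leP y m) => ym /=.
  by rewrite lexx backtrack_ge1 // /K; lia.
by rewrite ler01 backtrack_ge0 // /K; lia.
Qed.

(** The clipped scale function is superharmonic except at [a], where the walk
enters the trap; there it gains at most its first increment, which is at most
[1 / H] since the last increment of the trap is at least [H] times the first. *)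
Lemma quenched_trap_bound (a l n : nat) (H : R) :
  0 < H -> H <= prodrho w (a%:Z + 1) l ->
  iter n (step w) (fun x => (a%:Z + l%:Z < x)%R%:R) 0 <= n%:R / H.
Proof.
move=> H0 Hl; set D := scale w (a%:Z + l%:Z + 1) - scale w a.
have D0 : 0 < D.
  rewrite subr_gt0; apply: lt_le_trans (scale_le _ _ _ (_ : a%:Z + 1 <= _)).
    by rewrite -subr_gt0 scale_gap weight_gt0.
  by lia.
pose q x := - (scale w a / D) + D^-1 * scale w x.
have qS x : step w q x = q x by rewrite step_affine_scale.
have qE x : q x = (scale w x - scale w a) / D by rewrite /q; ring.
pose p x := Num.min 1 (q x).
have pS x : step w p x <= p x.
  by apply: le_trans (step_minr1 w _ x) _; rewrite qS.
have p0 x : a%:Z <= x -> 0 <= p x.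
  move=> ax; rewrite le_min ler01 /= qE; apply: divr_ge0; last exact: ltW.
  by rewrite subr_ge0 scale_le.
have p1 x : a%:Z + l%:Z < x -> p x = 1.
  move=> ax; rewrite /p; apply/min_idPl; rewrite qE ler_pdivlMr // mul1r.
  by rewrite lerB ?scale_le //; lia.
pose h x := if x <= a%:Z then 0 else p x.
have h1 : p (a%:Z + 1) <= H^-1.
  rewrite ge_min; apply/orP; right; rewrite qE scale_gap ler_pdivrMr //.
  rewrite mulrC ler_pdivlMr // mulrC.
  apply: le_trans (_ : weight w (a%:Z + l%:Z) <= _).
    by rewrite weightD mulrC ler_pM2l // weight_gt0.
  by rewrite -scale_gap lerB ?scale_le //; lia.
have hS x : step w h x <= h x + H^-1.
  rewrite {2}/h; case: (leP x a%:Z) => xa.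
    rewrite add0r; apply: (@le_trans _ _ (step w (fun=> H^-1) x)).
      apply: step_le; rewrite /h.
        case: ifPn => [_|xa1]; first by rewrite invr_ge0 ltW.
        by have -> : x = a%:Z by lia.
      have -> : (x - 1 <= a%:Z) = true by lia.
      by rewrite invr_ge0 ltW.
    by rewrite step_cst.
  apply: le_trans (_ : step w p x <= _); last first.
    by apply: le_trans (pS x) _; rewrite lerDl invr_ge0 ltW.
  by apply: step_le; rewrite /h; case: ifP => // xa1; apply: p0; lia.
have h0 : h 0 = 0 by [].
rewrite -[leRHS]add0r -h0.
apply: le_trans (iter_step_supersolution w n h _ 0 hS).
apply: iter_step_le => y _; rewrite /h.
case: (ltP (a%:Z + l%:Z) y) => ay /=.
  by rewrite p1 //; have -> : (y <= a%:Z) = false by lia.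
by case: ifPn => // ya; apply: p0; lia.
Qed.

End quenched_bounds.

(** * From the quenched law to the one-step operator *)

Section path_events.
Local Open Scope ereal_scope.

Lemma measurable_path_event n (S : set int) :
  measurable [set X : path_space | S (X n)].
Proof.
pose C (s : seq int) : set path_space :=
  [set X | cylinder n (nth 0%R s) X /\ S (nth 0%R s n)].
have -> : [set X : path_space | S (X n)] = \bigcup_s C s.
  apply/seteqP; split => [X SX|X [s _ [Xs Ss]]]; last by rewrite /= Xs.
  exists (mkseq X n.+1) => //; split; last by rewrite nth_mkseq.
  by move=> k kn; rewrite nth_mkseq.
apply: countable_bigcupT_measurable => [|s]; first exact: countableP.
have [Ss|Ss] := pselect (S (nth 0%R s n)); last first.
  rewrite (_ : C s = set0); first exact: measurable0.
  by rewrite -subset0 => X [].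
rewrite (_ : C s = cylinder n (nth 0%R s)).
  by apply: sub_gen_smallest; exists n, (nth 0%R s).
by apply/seteqP; split => [X []|X].
Qed.

Context {R : realType} (w : env R) (Q : probability path_space R).
Hypothesis hQ : is_quenched_law w Q.

Lemma quenched_transition n (j i : int) (p : R) :
  (Q [set X | X n = i] != 0 ->
    cond_prob Q [set X | X n.+1 = j] [set X | X n = i] = p%:E) ->
  Q ([set X | X n.+1 = j] `&` [set X | X n = i]) = p%:E * Q [set X | X n = i].
Proof.
set A := (X in Q (X `&` _)); set B := (X in Q (_ `&` X)) => h.
have mA : measurable (A : set path_space) by exact: (measurable_path_event n.+1 [set j]).
have mB : measurable (B : set path_space) by exact: (measurable_path_event n [set i]).
have [B0|B0] := eqVneq (Q B) 0.
  rewrite B0 mule0; apply/eqP; rewrite eq_le measure_ge0 andbT -B0.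
  apply: le_measure; rewrite ?inE //.
  exact: measurableI.
have := h B0; rewrite /cond_prob => <-.
have Bf : Q B \is a fin_num by exact: fin_num_measure.
rewrite -muleA -{2}(fineK Bf) -[in X in _ * X](fineK Bf) inver.
have B0' : fine (Q B) != 0%R by rewrite -eqe fineK.
by rewrite (negbTE B0') -EFinM mulVf // mule1.
Qed.

(** Keeping only the two nearest-neighbour moves into [j] gives an inequality,
which is all that is needed: the masses on the right sum to at most [1] and
those on the left to [1], so the reverse bound follows by complement in
[quenched_marginal_le]. *)
Lemma quenched_marginal_ge n (j : int) :
  (iter n (step w) (fun x => (x == j)%:R)%R 0)%:E <= Q [set X | X n = j].
Proof.
case: hQ => Q0 _ Qs.
elim: n j => [|n ih] j.
  rewrite /=; have [<-|j0] := eqVneq 0%R j; first by rewrite Q0.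
  exact: measure_ge0.
rewrite iterSr.
have -> : step w (fun x => (x == j)%:R)%R =
    ((fun x => omega w (j - 1) * (x == j - 1)%:R) \+
     (fun x => (1 - omega w (j + 1)) * (x == j + 1)%:R))%R.
  apply/funext => x; rewrite /step /=.
  have -> : (x + 1 == j)%R = (x == j - 1)%R by lia.
  have -> : (x - 1 == j)%R = (x == j + 1)%R by lia.
  by congr (_ + _)%R; case: eqP => [->|]; rewrite ?mulr0.
rewrite iter_stepD !iter_stepZ /= EFinD !EFinM.
have up := @quenched_transition n j (j - 1) (omega w (j - 1)).
have dn := @quenched_transition n j (j + 1) (1 - omega w (j + 1)).
have {}up := up (fun h => eq_ind _ (fun z : int => cond_prob Q
  [set X | X n.+1 = z] _ = _) (Qs n (j - 1)%R h).1 _ (subrK 1%R j)).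
have {}dn := dn (fun h => eq_ind _ (fun z : int => cond_prob Q
  [set X | X n.+1 = z] _ = _) (Qs n (j + 1)%R h).2 _ (addrK 1%R j)).
set U := (X in Q X = _) in up; set D := (X in Q X = _) in dn.
have mU : measurable (U : set path_space).
  by apply: measurableI; [exact: (measurable_path_event n.+1 [set j]) |
    exact: (measurable_path_event n [set (j - 1)%R])].
have mD : measurable (D : set path_space).
  by apply: measurableI; [exact: (measurable_path_event n.+1 [set j]) |
    exact: (measurable_path_event n [set (j + 1)%R])].
apply: (@le_trans _ _ (Q (U `|` D))).
  have -> : Q (U `|` D) = Q U + Q D.
    apply: measureU => //.
    by rewrite -subset0 => X [[_ /= e1] [_ /= e2]]; lia.
  rewrite up dn; apply: leeD; apply: lee_wpmul2l => //.
    by rewrite lee_fin ltW ?omega_gt0.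
  by rewrite lee_fin subr_ge0 ltW ?omega_lt1.
apply: le_measure; rewrite ?inE //.
- exact: measurableU.
- exact: (measurable_path_event n.+1 [set j]).
- by move=> X [[]|[]].
Qed.

(** Induction on the right end of the window [- n, n] bounds from below the
probability that [X_n] avoids [S] inside the window; outside, the iterates do
not see the indicator. *)
Lemma quenched_marginal_le n (S : pred int) :
  Q [set X | S (X n)] <= (iter n (step w) (fun x => (S x)%:R)%R 0)%:E.
Proof.
pose T N (x : int) := [&& ~~ S x, (- n%:Z <= x)%R & (x < N%:Z - n%:Z)%R].
have hT N : (iter n (step w) (fun x => (T N x)%:R)%R 0)%:E <=
    Q [set X | T N (X n)].
  elim: N => [|N ih].
    apply: (@le_trans _ _ 0) => //; rewrite lee_fin.
    rewrite -[leRHS](congr1 (fun f => f 0%R) (iter_step_cst w n 0%R)).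
    by apply: iter_step_le => y _; have -> : T 0%N y = false by rewrite /T; lia.
  have [SN|SN] := boolP (S (N%:Z - n%:Z)%R).
    have e : T N.+1 = T N.
      apply/funext => x; rewrite /T.
      have [->|xN] := eqVneq x (N%:Z - n%:Z)%R; first by rewrite SN.
      congr (~~ _ && (_ && _)); lia.
    by rewrite e.
  have e x : T N.+1 x = (T N x) || (x == N%:Z - n%:Z)%R.
    rewrite /T; have [->|xN] := eqVneq x (N%:Z - n%:Z)%R.
      by rewrite SN orbT; lia.
    by rewrite orbF; congr (~~ _ && (_ && _)); lia.
  have -> : (fun x => (T N.+1 x)%:R)%R =
      ((fun x => (T N x)%:R) \+ (fun x => (x == (N%:Z - n%:Z))%:R)%R)%R :> (_ -> R).
    apply/funext => x /=; rewrite e.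
    have [->|xN] := eqVneq x (N%:Z - n%:Z)%R; last by rewrite orbF addr0.
    have -> : T N (N%:Z - n%:Z)%R = false by rewrite /T; lia.
    by rewrite add0r.
  rewrite iter_stepD /= EFinD.
  have -> : [set X : path_space | T N.+1 (X n)] =
      [set X : path_space | T N (X n)] `|` [set X : path_space | X n = N%:Z - n%:Z]%R.
    apply/seteqP; split => X /=; rewrite e.
      by move=> /orP[|/eqP]; [left|right].
    by move=> [->//|->]; rewrite eqxx orbT.
  rewrite measureU.
  - by apply: leeD => //; exact: quenched_marginal_ge.
  - exact: (measurable_path_event n [set x | T N x]).
  - exact: (measurable_path_event n [set (N%:Z - n%:Z)%R]).
  - by rewrite -subset0 => X [/= + e1]; rewrite e1 /T; lia.
have mS : measurable [set X : path_space | S (X n)].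
  exact: (measurable_path_event n [set x | S x]).
have Qf : Q [set X | S (X n)] \is a fin_num by exact: fin_num_measure.
have hC : (1 - iter n (step w) (fun x => (S x)%:R)%R 0%R)%:E <=
    Q (~` [set X | S (X n)]).
  apply: le_trans (le_trans (hT (n + n).+1) _); last first.
    apply: le_measure; rewrite ?inE.
    - exact: (measurable_path_event n [set x | T (n + n).+1 x]).
    - exact: measurableC.
    - by move=> X /= /andP[/negP].
  rewrite lee_fin.
  rewrite [leLHS](_ : _ =
      iter n (step w) ((fun=> 1) \+ (fun x => -1 * (S x)%:R))%R 0%R).
    apply: iter_step_le => y hy /=.
    have -> : T (n + n).+1 y = ~~ S y by rewrite /T; lia.
    by rewrite mulN1r; case: (S y); rewrite /= ?subrr ?subr0.
  by rewrite iter_stepD iter_stepZ iter_step_cst /= mulN1r.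
move: hC; rewrite probability_setC // -(fineK Qf) -EFinB !lee_fin; lra.
Qed.

End path_events.

(** * Upper and lower limits as eventual bounds *)

Section limit_bounds.
Context {R : realType}.
Implicit Type u : (\bar R)^nat.
Local Open Scope ereal_scope.

Lemma limn_esup_lt u c : limn_esup u < c -> \forall n \near \oo, u n < c.
Proof.
move=> /ereal_inf_lt[_ [V FV <-] Vc]; apply: filterS FV => n Vn.
by apply: le_lt_trans Vc; apply: ereal_sup_ubound; exists n.
Qed.

Lemma limn_esup_le u c : (\forall n \near \oo, u n <= c) -> limn_esup u <= c.
Proof.
move=> uc; apply: (@le_trans _ _ (ereal_sup (u @` [set n | u n <= c]))).
  by apply: ereal_inf_lbound; exists [set n | u n <= c].
by apply: ge_ereal_sup => _ [n /= unc <-].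
Qed.

Lemma limn_einf_gt u c : c < limn_einf u -> \forall n \near \oo, c < u n.
Proof.
rewrite /limn_einf lteNr => /limn_esup_lt; apply: filterS => n.
by rewrite lteN2.
Qed.

End limit_bounds.

(** * Measurability and stationarity of the environment *)

Section environment_measurability.
Context {R : realType}.

Lemma measurable_omega i : measurable_fun setT (fun w : env R => omega w i).
Proof.
apply: (measurability _ (RGenOpens.measurableE R)) => _ [_ [a [b ->]] <-].
rewrite setTI; apply: sub_gen_smallest.
have oab : open (`]a, b[%classic : set R) by exact: interval_open.
have cV : continuous (set_val : set_type (`]0, 1[%classic : set R) -> R).
  exact: initial_continuous.
have cp : continuous (fun w : env_space R => (w i : set_type (`]0, 1[%classic : set R))).
  exact: (@proj_continuous int (fun=> set_type (`]0, 1[%classic : set R)) i).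
have oU := (continuousP _).1 cV _ oab.
have oW := (continuousP _).1 cp _ oU.
exact: oW.
Qed.

(** The next two results are stated for a map [phi] into environments because they
are applied to the identity both on all environments and on environments with the
sigma-algebra generated by a set of coordinates. *)
Context d (T : measurableType d) (phi : T -> env R).

Lemma measurable_ln_rho i :
  measurable_fun setT (fun t => omega (phi t) i) ->
  measurable_fun setT (fun t => ln (rho (phi t) i)).
Proof.
move=> mo.
rewrite (_ : (fun t => _) =
    ((fun t => ln (1 - omega (phi t) i)) \- (fun t => ln (omega (phi t) i)))).
  apply: measurable_funB.
    apply: (measurableT_comp (@measurable_ln R)).
    by apply: measurable_funB.
  exact: (measurableT_comp (@measurable_ln R)).
apply/funext => t /=; rewrite /rho ln_div ?posrE ?omega_gt0 //.
by rewrite subr_gt0 omega_lt1.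
Qed.

Lemma measurable_sum_ln_rho (a : int) n :
  (forall k : nat, (k < n)%N ->
    measurable_fun setT (fun t => omega (phi t) (a + k%:Z))) ->
  measurable_fun setT (fun t => \sum_(0 <= k < n) ln (rho (phi t) (a + k%:Z))).
Proof.
move=> mo; have {}mo (k : 'I_n) : measurable_fun setT
  (fun t => ln (rho (phi t) (a + k%:Z))) by apply: measurable_ln_rho; exact: mo.
under eq_fun do rewrite big_mkord.
by apply: measurable_sum => k; exact: mo.
Qed.

End environment_measurability.

Lemma shift_invariant_cst {T : Type} (f : int -> T) :
  (forall i, f (i + 1) = f i) -> forall i, f i = f 0.
Proof.
move=> f1; case=> m; first by elim: m => // m <-; rewrite -addn1 PoszD f1.
elim: m => [|m <-]; first by rewrite -(f1 (Negz 0)).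
by rewrite -(f1 (Negz m.+1)); congr f; lia.
Qed.

Section products.
Context {R : realType}.
Implicit Type w : env R.

Lemma prodrhoE w i n :
  prodrho w i n = expR (\sum_(0 <= k < n) ln (rho w (i + k%:Z))).
Proof.
rewrite expR_sum; apply: eq_bigr => k _; by rewrite lnK ?posrE ?rho_gt0.
Qed.

Lemma prodrho_mean_log_rho w n : (0 < n)%N ->
  prodrho w 0 n = expR (n%:R * mean_log_rho n w).
Proof.
move=> n0; rewrite prodrhoE /mean_log_rho mulrA divff ?mul1r; last first.
  by rewrite pnatr_eq0 -lt0n.
by congr expR; apply: eq_bigr => k _; rewrite add0r.
Qed.

Lemma prodrho_powR w i n lam :
  prodrho w i n `^ lam = expR (lam * \sum_(0 <= k < n) ln (rho w (i + k%:Z))).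
Proof. by rewrite prodrhoE -expRM mulrC. Qed.

Lemma prod_rho_powR w n lam :
  \prod_(0 <= k < n) rho w k%:Z `^ lam = prodrho w 0 n `^ lam.
Proof.
rewrite prodrho_powR mulr_sumr expR_sum; apply: eq_bigr => k _.
by rewrite add0r /powR gt_eqF ?rho_gt0.
Qed.

Lemma prodrhoD w i m n :
  prodrho w i (m + n) = prodrho w i m * prodrho w (i + m%:Z) n.
Proof.
rewrite !prodrhoE -expRD (big_cat_nat (n := m)) //=; last exact: leq_addr.
congr (expR (_ + _)); rewrite -{1}[m]add0n big_addn addKn.
by apply: eq_bigr => k _; rewrite -addrA -PoszD addnC.
Qed.

Lemma measurable_prodrho i n : measurable_fun setT (fun w : env R => prodrho w i n).
Proof.
under eq_fun do rewrite prodrhoE.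
apply: measurableT_comp => //.
by apply: (@measurable_sum_ln_rho R _ _ id) => k _; exact: measurable_omega.
Qed.

Lemma measurable_mean_log_rho n : measurable_fun setT (@mean_log_rho R n).
Proof.
apply: measurable_funM => //.
have := @measurable_sum_ln_rho R _ _ (id : env R -> env R) 0 n.
under eq_fun do under eq_bigr do rewrite add0r.
by apply => k _; exact: measurable_omega.
Qed.

Definition moment (P : probability (env R) R) (lam : R) (n : nat) : \bar R :=
  (\int[P]_w (prodrho w 0 n `^ lam)%:E)%E.

Lemma log_moment_growthE (P : probability (env R) R) lam :
  log_moment_growth P lam =
  limn_esup (fun n => n%:R^-1%:E * lne (moment P lam n))%E.
Proof.
congr limn_esup; apply/funext => n; congr (_ * lne _)%E.
rewrite unlock /moment; apply: eq_integral => w _.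
by rewrite prod_rho_powR.
Qed.

Lemma measurable_prodrho_powR i n lam :
  measurable_fun setT (fun w : env R => (prodrho w i n `^ lam)%:E).
Proof.
apply/measurable_EFinP.
apply: (measurableT_comp (measurable_powR lam)); exact: measurable_prodrho.
Qed.

Lemma prodrho_shift w i n : prodrho (env_shift w) i n = prodrho w (i + 1) n.
Proof. by apply: eq_bigr => k _; rewrite addrAC. Qed.

(** The images of [P] under the products that start at [j] and at [j + 1] are the
same measure on the line. *)
Lemma moment_shift (P : probability (env R) R) lam i n : stationary P ->
  (\int[P]_w (prodrho w i n `^ lam)%:E)%E = moment P lam n.
Proof.
move=> sP.
have shift1 j : (\int[P]_w (prodrho w (j + 1) n `^ lam)%:E)%E =
    (\int[P]_w (prodrho w j n `^ lam)%:E)%E.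
  pose f (x : R) := (x `^ lam)%:E.
  have mf : measurable_fun setT f by apply/measurable_EFinP; exact: measurable_powR.
  have pos : {in [set: R], forall x, (0 <= f x)%E}.
    by move=> x _; rewrite lee_fin powR_ge0.
  have e k := ge0_integral_pushforward (measurable_prodrho k n) P
    (@measurableT _ R) mf pos.
  transitivity (\int[pushforward P (fun w => prodrho w (j + 1)%R n)]_(y in setT) f y)%E.
    by rewrite e preimage_setT.
  transitivity (\int[pushforward P (fun w => prodrho w j n)]_(y in setT) f y)%E.
    apply: eq_measure_integral => [||? ? A mA _]; try exact: measurable_prodrho.
    rewrite /= /pushforward.
    have mB : measurable ((fun w : env R => prodrho w j n) @^-1` A).
      by rewrite -[X in measurable X]setTI; exact: measurable_prodrho.
    rewrite -(sP _ mB); congr (P _); apply/seteqP.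
    by split=> w /=; rewrite prodrho_shift.
  by rewrite e preimage_setT.
exact: (shift_invariant_cst (fun j => \int[P]_w (prodrho w j n `^ lam)%:E)%E).
Qed.

End products.

(** * Consequences of the large deviation principle *)

Section exponential_rates.
Context {R : realType}.
Implicit Types (p : \bar R) (c : R) (n : nat).

Lemma lne_rate_lt n p c : (0 < n)%N -> (0 <= p)%E ->
  (n%:R^-1%:E * lne p < c%:E)%E -> (p <= (expR (n%:R * c))%:E)%E.
Proof.
move=> n0; have n0R : 0 < n%:R :> R by rewrite ltr0n.
case: p => [p| |] //; last first.
  by move=> _; rewrite /= mulry gtr0_sg ?invr_gt0 // mul1e.
rewrite lee_fin le_eqVlt => /predU1P[<- _|p0].
  by rewrite lee_fin expR_ge0.
rewrite lne_EFin // -EFinM lte_fin lee_fin mulrC ltr_pdivrMr // mulrC => h.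
by rewrite -[leLHS]lnK ?posrE // ler_expR ltW.
Qed.

Lemma lne_rate_gt n p c : (0 < n)%N -> (0 <= p)%E ->
  (c%:E < n%:R^-1%:E * lne p)%E -> ((expR (n%:R * c))%:E <= p)%E.
Proof.
move=> n0; have n0R : 0 < n%:R :> R by rewrite ltr0n.
case: p => [p| |] //; last by move=> _ _; rewrite leey.
rewrite lee_fin le_eqVlt => /predU1P[<-|p0].
  by rewrite le0_lneNy // mulrNy gtr0_sg ?invr_gt0 // mul1e ltNge leNye.
rewrite lne_EFin // -EFinM lte_fin lee_fin mulrC ltr_pdivlMr // mulrC => h.
by rewrite -[leRHS]lnK ?posrE // ler_expR ltW.
Qed.

Lemma lne_rate_le n p c : (0 < n)%N -> (0 <= p)%E ->
  (p <= (expR (n%:R * c))%:E)%E -> (n%:R^-1%:E * lne p <= c%:E)%E.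
Proof.
move=> n0; have n0R : 0 < n%:R :> R by rewrite ltr0n.
case: p => [p| |] //.
rewrite lee_fin le_eqVlt => /predU1P[<- _|p0].
  by rewrite le0_lneNy // mulrNy gtr0_sg ?invr_gt0 // mul1e leNye.
rewrite lne_EFin // -EFinM !lee_fin => h.
rewrite mulrC ler_pdivrMr // mulrC.
by rewrite -ler_expR lnK ?posrE.
Qed.

Lemma measure_le_integral d (T : measurableType d) (P : probability T R)
    (f : T -> R) (B : set T) c :
  measurable_fun setT f -> (forall t, 0 <= f t) -> measurable B -> 0 <= c ->
  (forall t, B t -> c <= f t) -> (c%:E * P B <= \int[P]_t (f t)%:E)%E.
Proof.
move=> mf f0 mB c0 cf.
have mi : measurable_fun setT (fun t => (\1_B t)%:E : \bar R).
  by apply/measurable_EFinP; exact: measurable_indic.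
have -> : P B = (\int[P]_t (\1_B t)%:E)%E by rewrite integral_indic // setIT.
rewrite -ge0_integralZl //.
apply: ge0_le_integral => //.
- by move=> t _; rewrite mule_ge0 // lee_fin.
- exact: measurable_funeM.
- exact/measurable_EFinP.
move=> t _; rewrite -EFinM lee_fin indicE.
have [tB|tB] := boolP (t \in B); last by rewrite mulr0.
by rewrite mulr1 cf //; exact: set_mem.
Qed.

End exponential_rates.

Section large_deviations.
Context {R : realType} (P : probability (env R) R) (J : R -> \bar R).

Lemma moment_ge0 lam n : (0 <= moment P lam n)%E.
Proof. by apply: integral_ge0 => w _; rewrite lee_fin powR_ge0. Qed.

Lemma moment_near_le lam L : (log_moment_growth P lam < L%:E)%E ->
  \forall n \near \oo, (moment P lam n <= (expR (n%:R * L))%:E)%E.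
Proof.
rewrite log_moment_growthE => /limn_esup_lt h; near=> n.
apply: lne_rate_lt.
- by near: n; exists 1%N.
- exact: moment_ge0.
- by near: n.
Unshelve. all: by end_near. Qed.

Lemma log_moment_growth_le lam L :
  (\forall n \near \oo, (moment P lam n <= (expR (n%:R * L))%:E)%E) ->
  (log_moment_growth P lam <= L%:E)%E.
Proof.
rewrite log_moment_growthE => h; apply: limn_esup_le; near=> n.
apply: lne_rate_le.
- by near: n; exists 1%N.
- exact: moment_ge0.
- by near: n.
Unshelve. all: by end_near. Qed.

Lemma measurable_mean_preimage n (A : set R) : measurable A ->
  measurable (@mean_log_rho R n @^-1` A).
Proof.
move=> mA; rewrite -[X in measurable X]setTI; exact: measurable_mean_log_rho.
Qed.

Lemma prodrho_powR_mean (w : env R) n lam : (0 < n)%N ->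
  prodrho w 0 n `^ lam = expR (n%:R * lam * mean_log_rho n w).
Proof. by move=> n0; rewrite prodrho_mean_log_rho // -expRM; congr expR; ring. Qed.

Hypothesis A2 : condA2 P J.

Lemma rate_ge0 x : (0 <= J x)%E.
Proof. by case: A2 => J0 _ _ _; exact: J0. Qed.

(** The lower bound of Varadhan's lemma at one point: near [x] the exponential of
[lam * n * mean_log_rho] is about [exp (n * lam * x)] and the event has
probability about [exp (- n * J x)], so their product is at most the moment. *)
Lemma rate_ge_affine lam L : 0 < lam -> (log_moment_growth P lam < L%:E)%E ->
  forall x, ((lam * x - L)%:E <= J x)%E.
Proof.
move=> lam0 hL x; rewrite leNgt; apply/negP => Jx.
have Jf : J x \is a fin_num.
  by rewrite ge0_fin_numE ?rate_ge0 // (lt_trans Jx) ?ltry.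
move: Jx; rewrite -(fineK Jf); set j := fine (J x); rewrite lte_fin => Jx.
pose t := lam * x - L - j.
have t0 : 0 < t by rewrite /t; lra.
pose dl := t / (4 * lam).
have dl0 : 0 < dl by rewrite divr_gt0 // mulr_gt0.
have lamdl : lam * dl = t / 4 by rewrite /dl; field; rewrite gt_eqF.
pose A : set R := `]x - dl, x + dl[%classic.
have mA : measurable A by exact: measurable_itv.
have Ax : A° x.
  have -> : A° = A by apply/interior_id; exact: interval_open.
  by rewrite /A /= in_itv /=; apply/andP; split; lra.
have low : ((- (j + t / 4))%:E <
    limn_einf (fun n => n%:R^-1%:E * lne (P (@mean_log_rho R n @^-1` A))))%E.
  case: A2 => _ _ /(_ A mA) + _; apply: lt_le_trans.
  rewrite EFinN lteN2; apply: (@le_lt_trans _ _ (J x)).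
    by apply: ereal_inf_lbound; exists x.
  by rewrite -(fineK Jf) lte_fin -/j; lra.
have /limn_einf_gt n1 := low.
have n2 := moment_near_le _ _ hL.
near \oo => n.
have n0 : (0 < n)%N by near: n; exists 1%N.
have n0R : 0 < n%:R :> R by rewrite ltr0n.
have h1 : ((expR (n%:R * - (j + t / 4)))%:E <= P (@mean_log_rho R n @^-1` A))%E.
  by apply: lne_rate_gt => //; near: n.
have h2 : (moment P lam n <= (expR (n%:R * L))%:E)%E by near: n.
have h3 : ((expR (n%:R * lam * (x - dl)))%:E * P (@mean_log_rho R n @^-1` A)
    <= moment P lam n)%E.
  apply: measure_le_integral.
  - by apply/measurable_EFinP; exact: measurable_prodrho_powR.
  - by move=> w; exact: powR_ge0.
  - exact: measurable_mean_preimage.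
  - exact: expR_ge0.
  move=> w; rewrite /A /= in_itv /= => /andP[wl _].
  rewrite prodrho_powR_mean // ler_expR ler_wpM2l ?mulr_ge0 // ltW //.
have e0 : (0 <= (expR (n%:R * lam * (x - dl)))%:E)%E by rewrite lee_fin expR_ge0.
have := le_trans (le_trans (lee_wpmul2l e0 h1) h3) h2.
rewrite -EFinM lee_fin -expRD ler_expR.
have -> : n%:R * lam * (x - dl) + n%:R * - (j + t / 4) =
    n%:R * (lam * x - lam * dl - j - t / 4) by ring.
by rewrite ler_pM2l // lamdl => h; move: t0; rewrite /t in h *; lra.
Unshelve. all: by end_near. Qed.

Hypothesis A3 : condA3 P.

Lemma moment_finite_near lam :
  \forall n \near \oo, (moment P lam n < +oo)%E.
Proof.
have /(_ lam) := A3; rewrite log_moment_growthE => /limn_esup_lt h.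
near=> n; rewrite ltey; apply/eqP => e.
have n0 : (0 < n)%N by near: n; exists 1%N.
have : (n%:R^-1%:E * lne (moment P lam n) < +oo)%E by near: n.
by rewrite e /= mulry gtr0_sg ?invr_gt0 ?ltr0n // mul1e ltxx.
Unshelve. all: by end_near. Qed.

Lemma log_moment_growth_bounded lam : exists2 L : R, 0 <= L &
  (log_moment_growth P lam < L%:E)%E.
Proof.
have := A3 lam; case: (log_moment_growth P lam) => [l| |] // _.
  exists (`|l| + 1); first by rewrite addr_ge0.
  by rewrite lte_fin (le_lt_trans (ler_norm l)) // ltrDl.
by exists 0 => //; rewrite ltNyr.
Qed.

(** The upper bound of Varadhan's lemma.  Below [- K] the integrand is small;
above [K] it is at most [exp (- n * lam * K)] times the integrand of the moment
of order [2 * lam], whose growth is bounded; in between, the line is cut into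
finitely many intervals on which [lam * x] varies by at most [c0 / 4], and the
large deviation bound is used on each. *)
Lemma moment_decay lam c0 : 0 < lam -> 0 < c0 ->
  (forall x, ((lam * x + c0)%:E <= J x)%E) ->
  exists2 c, 0 < c &
    \forall n \near \oo, (moment P lam n <= (expR (n%:R * - c))%:E)%E.
Proof.
move=> lam0 c00 hJ.
have [L L0 hL] := log_moment_growth_bounded (2 * lam).
pose K := (L + 1) / lam.
have lamK : lam * K = L + 1 by rewrite /K mulrC divfK // gt_eqF.
have K0 : 0 < K by rewrite divr_gt0 //; lra.
pose dl := c0 / (4 * lam).
have dl0 : 0 < dl by rewrite divr_gt0 // mulr_gt0.
have lamdl : lam * dl = c0 / 4 by rewrite /dl; field; rewrite gt_eqF.
pose N := (Num.trunc (2 * K / dl)).+1.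
have NK : 2 * K < N%:R * dl.
  by rewrite -ltr_pdivrMr //; apply: truncnS_gt.
pose a (k : nat) := - K + k%:R * dl.
pose I (k : nat) : set R := `[a k, a k + dl]%classic.
have mI k : measurable (I k) by exact: measurable_itv.
have hP : \forall n \near \oo, forall k : 'I_N,
    (P (@mean_log_rho R n @^-1` (I k)) <=
     (expR (n%:R * - (lam * a k + c0 - c0 / 4)))%:E)%E.
  apply: filter_forall => k.
  have up : (limn_esup (fun n => n%:R^-1%:E *
      lne (P (@mean_log_rho R n @^-1` (I k)))) <
      (- (lam * a k + c0 - c0 / 4))%:E)%E.
    case: A2 => _ _ _ /(_ _ (mI k)); move=> /le_lt_trans; apply.
    rewrite EFinN lteN2.
    apply: (@lt_le_trans _ _ (lam * a k + c0)%:E); first by rewrite lte_fin; lra.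
    apply: le_ereal_inf_tmp => _ [x clx <-]; apply: le_trans (hJ x).
    have : I k x.
      have cI : closed (I k) by exact: interval_closed.
      by rewrite ((closure_id _).1 cI).
    rewrite /I /= in_itv /= => /andP[ax _].
    by rewrite lee_fin lerD2r ler_pM2l.
  have /limn_esup_lt := up; move=> h; near=> n; apply: lne_rate_lt => //.
    by near: n; exists 1%N.
  by near: n.
have hM := moment_near_le _ _ hL.
pose c1 := Num.min 1 (c0 / 2).
have c10 : 0 < c1 by rewrite lt_min ltr01 divr_gt0.
exists (c1 / 2); first by rewrite divr_gt0.
near=> n.
have n0 : (0 < n)%N by near: n; exists 1%N.
have n0R : 0 < n%:R :> R by rewrite ltr0n.
have nbig : (N%:R + 2) / (c1 / 2) <= n%:R by near: n; exact: nbhs_infty_ger.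
pose f0 (w : env R) := (expR (- n%:R))%:E : \bar R.
pose f1 (w : env R) := ((expR (- (n%:R * (L + 1))))%:E *
  (prodrho w 0 n `^ (2 * lam))%:E)%E.
pose f2 (k : 'I_N) (w : env R) := ((expR (n%:R * (lam * (a k + dl))))%:E *
  (\1_(@mean_log_rho R n @^-1` (I k)) w)%:E)%E.
have mf0 : measurable_fun setT f0 by exact: measurable_cst.
have mf1 : measurable_fun setT f1.
  by apply: measurable_funeM; exact: measurable_prodrho_powR.
have mi k : measurable_fun setT
    (fun w => (\1_(@mean_log_rho R n @^-1` (I k)) w)%:E : \bar R).
  by apply/measurable_EFinP; apply: measurable_indic; exact: measurable_mean_preimage.
have mf2 k : measurable_fun setT (f2 k) by apply: measurable_funeM; exact: mi.
have f10 w : (0 <= f1 w)%E.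
  by rewrite mule_ge0 // lee_fin ?expR_ge0 ?powR_ge0.
have f20 k w : (0 <= f2 k w)%E by rewrite mule_ge0 // lee_fin ?expR_ge0.
have ptw w : ((prodrho w 0 n `^ lam)%:E <= f0 w + (f1 w + \sum_(k < N) f2 k w))%E.
  rewrite prodrho_powR_mean //; set v := mean_log_rho n w.
  (* The three terms dominate the integrand to the left of [- K], to the right of
     [K], and on the interval of the subdivision that contains [v]. *)
  have [vK|vK] := leP v (- K).
    apply: (@le_trans _ _ (f0 w)); last first.
      by rewrite leeDl // adde_ge0 // sume_ge0.
    rewrite /f0 lee_fin ler_expR -mulrA -mulrN1 ler_pM2l //.
    apply: (@le_trans _ _ (lam * (- K))); first by rewrite ler_pM2l.
    by rewrite mulrN lamK; lra.
  have [Kv|Kv] := leP K v.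
    apply: (@le_trans _ _ (f1 w)).
      rewrite /f1 prodrho_powR_mean // -/v -EFinM -expRD lee_fin ler_expR.
      rewrite -!mulrA -mulrN -mulrDr ler_pM2l // -lamK -mulrN.
      have : lam * K <= lam * v by rewrite ler_pM2l.
      by lra.
    apply: (@le_trans _ _ (f1 w + \sum_(k < N) f2 k w)%E).
      by rewrite leeDl // sume_ge0.
    by rewrite leeDr // lee_fin expR_ge0.
  pose k := Num.trunc ((v + K) / dl).
  have vK0 : 0 <= (v + K) / dl by rewrite divr_ge0 // ?ltW //; lra.
  have /andP[k1 k2] := truncn_itv vK0; rewrite -/k in k1 k2.
  have kN : (k < N)%N.
    rewrite ltnS /k; apply: le_truncn; rewrite ler_pM2r ?invr_gt0 //; lra.
  apply: (@le_trans _ _ (f2 (Ordinal kN) w)); last first.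
    apply: (@le_trans _ _ (\sum_(k < N) f2 k w)%E).
      by rewrite (bigD1 (Ordinal kN)) //= leeDl // sume_ge0.
    apply: (@le_trans _ _ (f1 w + \sum_(k < N) f2 k w)%E).
      by rewrite leeDr.
    by rewrite leeDr // lee_fin expR_ge0.
  have Iv : I k v.
    rewrite /I /a /= in_itv /=.
    move: k1 k2; rewrite ler_pdivlMr // ltr_pdivrMr // -natr1 mulrDl mul1r.
    by move=> ? ?; apply/andP; split; lra.
  have -> : f2 (Ordinal kN) w = (expR (n%:R * (lam * (a k + dl))))%:E.
    by rewrite /f2 indicE mem_set // mule1.
  rewrite lee_fin ler_expR -mulrA ler_pM2l // ler_pM2l //.
  by move: Iv; rewrite /I /= in_itv /= => /andP[].
have int : (moment P lam n <=
    (expR (- n%:R))%:E + ((expR (- (n%:R * (L + 1))))%:E * moment P (2 * lam) n +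
    \sum_(k < N) (expR (n%:R * (lam * (a k + dl))))%:E *
      P (@mean_log_rho R n @^-1` (I k))))%E.
  have -> : (\sum_(k < N) (expR (n%:R * (lam * (a k + dl))))%:E *
      P (@mean_log_rho R n @^-1` (I k)) = \int[P]_w (\sum_(k < N) f2 k w))%E.
    rewrite ge0_integral_sum //; apply: eq_bigr => k _.
    rewrite ge0_integralZl ?lee_fin ?expR_ge0 // integral_indic ?setIT //.
    exact: measurable_mean_preimage.
  have -> : ((expR (- (n%:R * (L + 1))))%:E * moment P (2 * lam) n =
      \int[P]_w f1 w)%E.
    rewrite ge0_integralZl ?lee_fin ?expR_ge0 //.
      exact: measurable_prodrho_powR.
    by move=> w _; rewrite lee_fin powR_ge0.
  have -> : ((expR (- n%:R))%:E = \int[P]_w f0 w)%E.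
    by rewrite /f0 integral_cst //= probability_setT mule1.
  have mS : measurable_fun setT (fun w => \sum_(k < N) f2 k w)%E.
    by apply: emeasurable_sum.
  have S0 w : (0 <= \sum_(k < N) f2 k w)%E by rewrite sume_ge0.
  rewrite -ge0_integralD // -ge0_integralD //.
  - apply: ge0_le_integral => //.
    + by move=> w _; rewrite lee_fin powR_ge0.
    + exact: measurable_prodrho_powR.
    + by apply: emeasurable_funD => //; exact: emeasurable_funD.
  - by move=> w _; rewrite lee_fin expR_ge0.
  - by move=> w _; rewrite adde_ge0.
  - exact: emeasurable_funD.
have e1 : expR (- n%:R) <= expR (n%:R * - c1).
  by rewrite ler_expR mulrN lerN2 ler_piMr ?(ltW n0R) // ge_min lexx.
apply: le_trans int _.
apply: (@le_trans _ _ ((expR (n%:R * - c1))%:E + ((expR (n%:R * - c1))%:E +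
    \sum_(k < N) (expR (n%:R * - c1))%:E))%E).
  apply: leeD; first by rewrite lee_fin.
  apply: leeD.
    apply: (@le_trans _ _ ((expR (- (n%:R * (L + 1))))%:E * (expR (n%:R * L))%:E)%E).
      by apply: lee_wpmul2l; [rewrite lee_fin expR_ge0 | near: n].
    rewrite -EFinM -expRD lee_fin; apply: le_trans e1.
    by rewrite ler_expR; lra.
  apply: lee_sum => k _.
  apply: (@le_trans _ _ ((expR (n%:R * (lam * (a k + dl))))%:E *
      (expR (n%:R * - (lam * a k + c0 - c0 / 4)))%:E)%E).
    apply: lee_wpmul2l; first by rewrite lee_fin expR_ge0.
    by move: k; near: n.
  rewrite -EFinM -expRD lee_fin ler_expR -mulrDr ler_pM2l // mulrDr lamdl.
  have : c1 <= c0 / 2 by rewrite ge_min lexx orbT.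
  lra.
rewrite sumEFin -!EFinD lee_fin sumr_const card_ord.
set e := expR (n%:R * - c1); rewrite -[e *+ N]mulr_natl.
have -> : e + (e + N%:R * e) = (N%:R + 2) * e by ring.
have ee : e = expR (n%:R * - (c1 / 2)) * expR (n%:R * - (c1 / 2)).
  by rewrite -expRD; congr expR; field.
rewrite ee mulrA -[leRHS]mul1r ler_pM2r ?expR_gt0 // mulrN expRN.
rewrite ler_pdivrMr ?expR_gt0 // mul1r.
apply: (@le_trans _ _ (n%:R * (c1 / 2))).
  by rewrite -ler_pdivrMr // divr_gt0.
by apply: le_trans (expR_ge1Dx _); rewrite lerDr.
Unshelve. all: by end_near. Qed.

End large_deviations.

(** * The exponent kappa *)

Section kappa_facts.
Context {R : realType} (P : probability (env R) R) (J : R -> \bar R).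
Hypotheses (sP : stationary P) (A2 : condA2 P J) (A3 : condA3 P).

(** Moments of long products are finite, and a short product is the quotient of
two long ones; [a / b <= a ^ 2 + b ^ (- 2)] separates them. *)
Lemma moment_finite lam n : (moment P lam n < +oo)%E.
Proof.
have [N1 _ f1] := moment_finite_near _ A3 (2 * lam).
have [N2 _ f2] := moment_finite_near _ A3 (2 * - lam).
pose N := maxn N1 N2.
have h1 : (moment P (2 * lam) (n + N)%N < +oo)%E.
  by apply: f1 => /=; apply: leq_trans (leq_maxl N1 N2) (leq_addl _ _).
have h2 : (moment P (2 * - lam) N < +oo)%E by apply: f2; exact: leq_maxr.
pose g1 w := (prodrho w 0 (n + N) `^ (2 * lam))%:E.
pose g2 w := (prodrho w n N `^ (2 * - lam))%:E.
apply: (@le_lt_trans _ _ (\int[P]_w (g1 w + g2 w))%E).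
  apply: ge0_le_integral => //.
  - by move=> w _; rewrite lee_fin powR_ge0.
  - exact: measurable_prodrho_powR.
  - by apply: emeasurable_funD; exact: measurable_prodrho_powR.
  move=> w _; rewrite /g1 /g2 -EFinD lee_fin.
  rewrite prodrhoD add0r !(mulrC 2) !powRrM powRM; first last.
  - exact/ltW/prodrho_gt0.
  - exact/ltW/prodrho_gt0.
  rewrite powRN; set a := _ `^ lam; set b := _ `^ lam.
  have a0 : 0 < a by apply: powR_gt0; exact: prodrho_gt0.
  have b0 : 0 < b by apply: powR_gt0; exact: prodrho_gt0.
  rewrite !powR_mulrn ?mulr_ge0 ?invr_ge0 ?(ltW a0) ?(ltW b0) //.
  have -> : a = (a * b) * b^-1 by rewrite mulfK ?gt_eqF.
  rewrite mulfVK ?gt_eqF //.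
  have := sqr_ge0 (a * b - b^-1); rewrite sqrrB => h.
  have : 0 <= a * b * b^-1.
    by apply: mulr_ge0; [exact/ltW/mulr_gt0 | rewrite invr_ge0 ltW].
  by rewrite -mulr_natr in h; lra.
rewrite ge0_integralD //.
- apply: lte_add_pinfty; first exact: h1.
  by have -> := moment_shift P (2 * - lam) n N sP.
- by move=> w _; rewrite lee_fin powR_ge0.
- exact: measurable_prodrho_powR.
- by move=> w _; rewrite lee_fin powR_ge0.
- exact: measurable_prodrho_powR.
Qed.

Lemma moment_geometric lam c : 0 < c ->
  (\forall n \near \oo, (moment P lam n <= (expR (n%:R * - c))%:E)%E) ->
  exists C r, [/\ 0 <= C, 0 < r, r < 1 &
    forall n, (moment P lam n <= (C * r ^+ n)%:E)%E].
Proof.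
move=> c0 [N _ hN]; pose r := expR (- c).
have r0 : 0 < r by exact: expR_gt0.
have term0 k : 0 <= fine (moment P lam k) / r ^+ k.
  by rewrite divr_ge0 ?fine_ge0 ?moment_ge0 ?exprn_ge0 ?(ltW r0).
pose C := 1 + \sum_(k < N) fine (moment P lam k) / r ^+ k.
exists C, r; split => //.
- by rewrite addr_ge0 // sumr_ge0.
- by rewrite expR_lt1 oppr_lt0.
move=> n; have rn0 : 0 < r ^+ n by exact: exprn_gt0.
have [nN|Nn] := ltnP n N.
  rewrite -[leLHS]fineK; last by rewrite ge0_fin_numE ?moment_ge0 ?moment_finite.
  rewrite lee_fin -ler_pdivrMr // /C (bigD1 (Ordinal nN)) //= addrCA lerDl.
  by rewrite addr_ge0 // sumr_ge0.
apply: le_trans (hN n Nn) _; rewrite lee_fin mulrC expRM_natr -/r.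
by rewrite ler_peMl ?(ltW rn0) // /C lerDl sumr_ge0.
Qed.

Lemma kappa_le x : 0 < x -> (kappa J <= rate_ratio J x)%E.
Proof. by move=> x0; apply: ereal_inf_lbound; exists x. Qed.

Lemma rate_ge_kappa k x : (k%:E <= kappa J)%E -> 0 < x -> ((k * x)%:E <= J x)%E.
Proof.
move=> kk x0; have := le_trans kk (kappa_le x x0); rewrite /rate_ratio.
have := rate_ge0 _ _ A2 x; case: (J x) => [j| |] // _; last by rewrite leey.
by rewrite -EFinM !lee_fin -ler_pdivlMr.
Qed.

Hypothesis A4 : condA4 P.

Lemma rate_ge_affine_pos : exists lam1 c, [/\ 0 < lam1, 0 < c &
  forall x, ((lam1 * x + c)%:E <= J x)%E].
Proof.
case: A4 => _ [lam1 lam10 h].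
have [L L0 hL] : exists2 L, L < 0 & (log_moment_growth P lam1 < L%:E)%E.
  move: h; case: (log_moment_growth P lam1) => [l| |] //.
    by rewrite lte_fin => l0; exists (l / 2); rewrite ?lte_fin; lra.
  by move=> _; exists (-1); rewrite ?ltrN10 ?ltNyr.
exists lam1, (- L); split => //; first by rewrite oppr_gt0.
by move=> x; have := rate_ge_affine _ _ A2 _ _ lam10 hL x.
Qed.

(** For [lam] below the slope [l1] of the bound with positive constant term, this
bound is averaged with [J >= 0].  For larger [lam] the same bound does for
[x <= 0], and for [x > 0] it is averaged with [J x >= k * x], where
[lam < k <= kappa]. *)
Lemma rate_ge_affine_kappa lam : 0 < lam -> (lam%:E < kappa J)%E ->
  exists2 c0, 0 < c0 & forall x, ((lam * x + c0)%:E <= J x)%E.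
Proof.
move=> lam0 lamk; have [l1 [c [l10 c0 hJ]]] := rate_ge_affine_pos.
have [ll1|l1l] := ltP lam l1.
  exists (lam / l1 * c) => [|x]; first by rewrite mulr_gt0 ?divr_gt0.
  have := hJ x; have := rate_ge0 _ _ A2 x.
  case: (J x) => [j| |] //; last by rewrite !leey.
  rewrite !lee_fin => j0 jx.
  have t0 : 0 < lam / l1 by rewrite divr_gt0.
  have t1 : lam / l1 <= 1 by rewrite ler_pdivrMr // mul1r ltW.
  have -> : lam * x + lam / l1 * c = lam / l1 * (l1 * x + c).
    by field; rewrite gt_eqF.
  by apply: le_trans (ler_wpM2l (ltW t0) jx) _; rewrite ler_piMl.
have [k lk kk] : exists2 k, lam < k & (k%:E <= kappa J)%E.
  case: (kappa J) lamk => [k| |] //.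
    by rewrite lte_fin => lk; exists k.
  by move=> _; exists (lam + 1); rewrite ?ltrDl ?leey.
pose t := (lam - l1) / (k - l1).
have kl : 0 < k - l1 by lra.
have t0 : 0 <= t by rewrite divr_ge0 //; lra.
have t1 : t < 1 by rewrite ltr_pdivrMr // mul1r; lra.
have lamt : lam = (1 - t) * l1 + t * k by rewrite /t; field; rewrite gt_eqF.
exists ((1 - t) * c) => [|x]; first by rewrite mulr_gt0 //; lra.
have [x0|x0] := leP x 0.
  apply: le_trans (hJ x); rewrite lee_fin.
  have : 0 <= (lam - l1) * - x by rewrite mulr_ge0; lra.
  have : 0 <= t * c by rewrite mulr_ge0 // ltW.
  lra.
have := hJ x; have := rate_ge_kappa _ _ kk x0.
case: (J x) => [j| |] //; last by rewrite !leey.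
rewrite !lee_fin => j1 j2.
have := ler_wpM2l t0 j1; have s0 : 0 <= 1 - t by lra.
have := ler_wpM2l s0 j2; rewrite lamt; lra.
Qed.

Lemma kappa_le1 : (kappa J <= 1)%E.
Proof.
rewrite leNgt; apply/negP => k1.
have [c0 c00 hJ] := rate_ge_affine_kappa _ ltr01 k1.
have [c cpos hc] := moment_decay _ _ A2 A3 _ _ ltr01 c00 hJ.
have [+ _] := A4; rewrite leNgt => /negP; apply.
by apply: le_lt_trans (log_moment_growth_le _ _ _ hc) _; rewrite lte_fin oppr_lt0.
Qed.

Lemma moment_geometric_kappa lam : 0 < lam -> (lam%:E < kappa J)%E ->
  exists C r, [/\ 0 <= C, 0 < r, r < 1 &
    forall n, (moment P lam n <= (C * r ^+ n)%:E)%E].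
Proof.
move=> lam0 lamk; have [c0 c00 hJ] := rate_ge_affine_kappa _ lam0 lamk.
have [c cpos hc] := moment_decay _ _ A2 A3 _ _ lam0 c00 hJ.
exact: moment_geometric cpos hc.
Qed.

Lemma kappa_gt0 : (0 < kappa J)%E.
Proof.
have [l1 [c [l10 c0 hJ]]] := rate_ge_affine_pos.
apply: (@lt_le_trans _ _ l1%:E); first by rewrite lte_fin.
apply: le_ereal_inf_tmp => _ [x /= x0 <-]; rewrite /rate_ratio.
have := hJ x; case: (J x) => [j| |] //; last first.
  by move=> _; rewrite mulyr gtr0_sg ?invr_gt0 // mul1e leey.
rewrite -EFinM !lee_fin => h; rewrite ler_pdivlMr //; lra.
Qed.

(** The points with ratio at most [r], for [r] slightly above [kappa], lie in a fixed
compact interval, hence have a cluster point [y] as [r] decreases to [kappa].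
Closedness of the level sets of [J] yields [J y <= kappa * y]. *)
Lemma kappa_attained : exists2 y, 0 < y & rate_ratio J y = kappa J.
Proof.
have k1 := kappa_le1; have k0 := kappa_gt0.
have kf : kappa J \is a fin_num.
  by rewrite ge0_fin_numE ?(ltW k0) // (le_lt_trans k1) ?ltry.
set k := fine (kappa J); have kE : kappa J = k%:E by rewrite fineK.
have k1' : k <= 1 by rewrite -lee_fin -kE.
have k0' : 0 < k by rewrite -lte_fin -kE.
have [l1 [c [l10 c0 hJ]]] := rate_ge_affine_pos.
have [L L0 hL] := log_moment_growth_bounded _ A3 3.
have hJ3 := rate_ge_affine _ _ A2 3 L (ltr0Sn _ _) hL.
pose S (r : R) := [set y : R | 0 < y /\ (J y <= (r * y)%:E)%E].
pose lo := c / 2; pose hi := L.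
have Sb r y : r <= 2 -> S r y -> lo <= y /\ y <= hi.
  move=> r2 [y0 Jy]; have := le_trans (hJ y) Jy; have := le_trans (hJ3 y) Jy.
  have : r * y <= 2 * y by rewrite ler_pM2r.
  rewrite !lee_fin /lo /hi => h1 h2 h3; split; last by lra.
  have : 0 <= l1 * y by rewrite mulr_ge0 // ltW.
  lra.
have Sne r : k < r -> S r !=set0.
  move=> kr; have : (kappa J < r%:E)%E by rewrite kE lte_fin.
  move=> /ereal_inf_lt[_ [y /= y0 <-]] hy; exists y; split => //.
  move: hy; rewrite /rate_ratio; have := rate_ge0 _ _ A2 y.
  case: (J y) => [j| |] //.
    by move=> _; rewrite -EFinM lte_fin lee_fin ltr_pdivrMr // => /ltW.
  by move=> _; rewrite mulyr gtr0_sg ?invr_gt0 // mul1e.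
pose F : set_system R := [set A | exists2 r, k < r & S r `<=` A].
have FF : ProperFilter F.
  apply: Build_ProperFilter; last split.
  - by move=> [r kr sA]; have [y /sA] := Sne r kr.
  - by exists (k + 1) => //; rewrite ltrDl.
  - move=> A B [r kr sA] [s ks sB]; exists (Num.min r s).
      by rewrite lt_min kr.
    move=> y [y0 Jy]; split; [apply: sA|apply: sB]; split => //;
      apply: le_trans Jy _; rewrite lee_fin ler_pM2r // ge_min lexx ?orbT //.
  - by move=> A B AB [r kr sA]; exists r => //; exact: subset_trans AB.
have cpt : compact (`[lo, hi]%classic : set R) by exact: segment_compact.
have FI : F `[lo, hi]%classic.
  exists 2; first lra.
  by move=> y /(Sb 2 y (lexx _)) [? ?]; rewrite /= in_itv /=; apply/andP.
have [y [yI cly]] := cpt F FF FI.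
have ylo : lo <= y by move: yI; rewrite /= in_itv /= => /andP[].
have y0 : 0 < y by apply: lt_le_trans ylo; rewrite /lo divr_gt0.
exists y => //; apply/eqP; rewrite eq_le kappa_le // andbT.
suff : (J y <= (k * y)%:E)%E.
  rewrite /rate_ratio kE; have := rate_ge0 _ _ A2 y.
  case: (J y) => [j| |] // _.
  by rewrite -EFinM !lee_fin ler_pdivrMr.
apply/lee_addgt0Pr => e e0; rewrite -EFinD; set a := k * y + e.
have a0 : 0 < a by rewrite addr_gt0 // mulr_gt0.
have [_ cptJ _ _] := A2.
have clJ : closed [set x | (J x <= a%:E)%E].
  by apply: compact_closed; [exact: Rhausdorff | exact: cptJ].
suff : [set x | (J x <= a%:E)%E] y by [].
apply: clJ => B By.
(* With this choice [(k + d) * (y + d) <= k * y + e]. *)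
pose d := Num.min 1 (e / (k + (y + 1) + 1)).
have den : 0 < k + (y + 1) + 1 by lra.
have d0 : 0 < d by rewrite lt_min ltr01 divr_gt0.
have dd : d * (k + (y + 1) + 1) <= e.
  by rewrite -ler_pdivlMr // ge_min lexx orbT.
have d1 : d <= 1 by rewrite ge_min lexx.
have FS : F (S (k + d)) by exists (k + d) => //; rewrite ltrDl.
have Nb : nbhs y (B `&` ball y d) by apply: filterI => //; exact: nbhsx_ballx.
have [z [[z0 Jz] [Bz]]] := cly _ _ FS Nb.
rewrite /ball /= => zy; exists z; split => //=.
apply: le_trans Jz _; rewrite lee_fin /a.
have : z <= y + d.
  move: zy; rewrite ltr_norml => /andP[]; lra.
move=> zyd; have : (k + d) * z <= (k + d) * (y + d).
  by rewrite ler_wpM2l //; lra.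
have : d * d <= d by rewrite ler_piMl // ltW.
lra.
Qed.

End kappa_facts.

(** * Traps and mixing *)

Section quiet_blocks.
Context {R : realType}.

(** The complement of a trap of depth [c] on the [l] sites from [a] on. *)
Definition quiet (l : nat) (c : R) (a : int) : set (env R) :=
  [set w | \sum_(0 <= k < l) ln (rho w (a + k%:Z)) < c].

Definition quiet_blocks (l g : nat) (c : R) (k : nat) (a : int) : set (env R) :=
  [set w | forall i, (i < k)%N -> quiet l c (a + (i * (l + g))%N%:Z) w].

Lemma measurable_quiet d (T : measurableType d) (phi : T -> env R) l c a :
  (forall j : nat, (j < l)%N ->
    measurable_fun setT (fun t => omega (phi t) (a + j%:Z))) ->
  measurable (phi @^-1` quiet l c a).
Proof.
move=> mo; have mf := measurable_sum_ln_rho _ _ phi a l mo.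
have -> : phi @^-1` quiet l c a =
    setT `&` (fun t => \sum_(0 <= k < l) ln (rho (phi t) (a + k%:Z))) @^-1` `]-oo, c[.
  by rewrite setTI; apply/seteqP; split => t; rewrite /quiet /= in_itv.
by apply: mf => //; exact: measurable_itv.
Qed.

Lemma measurable_quiet_blocks d (T : measurableType d) (phi : T -> env R) l g c k a :
  (forall i j : nat, (i < k)%N -> (j < l)%N ->
    measurable_fun setT
      (fun t => omega (phi t) (a + (i * (l + g))%N%:Z + j%:Z))) ->
  measurable (phi @^-1` quiet_blocks l g c k a).
Proof.
move=> mo; have -> : phi @^-1` quiet_blocks l g c k a =
    \bigcap_i (if (i < k)%N then phi @^-1` quiet l c (a + (i * (l + g))%N%:Z)
               else setT).
  apply/seteqP; split => t h i => [_|ik].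
    by case: ifPn => // ik; exact: h.
  by have := h i I; rewrite ik.
apply: bigcapT_measurable => i; case: ifPn => // ik.
by apply: measurable_quiet => j; exact: mo.
Qed.

Lemma sigma_coord_quiet_blocks (I : set int) l g c k a :
  (forall i j : nat, (i < k)%N -> (j < l)%N -> I (a + (i * (l + g))%N%:Z + j%:Z)) ->
  sigma_coord I (quiet_blocks l g c k a).
Proof.
move=> hI.
pose G : set (set (env R)) := \bigcup_(i in I)
  preimage_set_system setT (fun w : env R => omega w i) measurable.
apply: (@measurable_quiet_blocks _ (g_sigma_algebraType G) id) => i j ik jl.
move=> _ A mA; apply: sub_gen_smallest.
by exists (a + (i * (l + g))%N%:Z + j%:Z); [exact: hI | exists A].
Qed.

Lemma measurable_quiet_blocks_env l g c k a :
  measurable (quiet_blocks l g c k a : set (env R)).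
Proof.
by apply: (@measurable_quiet_blocks _ _ id) => i j _ _; exact: measurable_omega.
Qed.

Lemma quiet_blocks1 l g c a : quiet_blocks l g c 1 a = quiet l c a.
Proof.
apply/seteqP; split => w h.
  by have := h 0%N (ltn0Sn 0); rewrite mul0n addr0.
by move=> [|//] _; rewrite mul0n addr0.
Qed.

Lemma quiet_blocksS l g c k a : quiet_blocks l g c k.+1 a =
  quiet l c a `&` quiet_blocks l g c k (a + (l + g)%N%:Z).
Proof.
apply/seteqP; split => w h.
  split; first by have := h 0%N (ltn0Sn k); rewrite mul0n addr0.
  by move=> i ik; have := h i.+1 ik; rewrite mulSn PoszD addrA.
move=> [_|i ik]; first by rewrite mul0n addr0; case: h.
by rewrite mulSn PoszD addrA; apply h.2.
Qed.

Context (P : probability (env R) R).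
Hypothesis sP : stationary P.

Lemma quiet_blocks_shift l g c k a :
  P (quiet_blocks l g c k a) = P (quiet_blocks l g c k 0).
Proof.
apply: (shift_invariant_cst (fun a => P (quiet_blocks l g c k a))) => i.
rewrite -[RHS]sP; last exact: measurable_quiet_blocks_env.
have e N w : quiet l c (i + 1 + N) w = quiet l c (i + N) (env_shift w).
  congr is_true; congr (_ < c); apply: eq_bigr => j _; congr ln.
  change (rho w (i + 1 + N + j%:Z) = rho w (i + N + j%:Z + 1)).
  by congr (rho w); lia.
by congr (P _); apply/seteqP; split => w h j jk; have := h j jk; rewrite ?e // -e.
Qed.

Lemma sigma_coord_measurable I : sigma_coord I `<=` (@measurable _ (env R)).
Proof.
apply: smallest_sub; first exact: sigma_algebra_measurable.
by move=> _ [i _ [A mA <-]]; exact: measurable_omega.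
Qed.

Lemma mixing_coef_ge n (A B : set (env R)) :
  sigma_coord [set i : int | i <= 0] A -> sigma_coord [set i : int | n%:Z <= i] B ->
  `|fine (P (A `&` B)) - fine (P A) * fine (P B)| <= mixing_coef P n.
Proof.
move=> sA sB; apply: sup_upper_bound; last by exists A, B.
split; first by exists (`|fine (P (A `&` B)) - fine (P A) * fine (P B)|); exists A, B.
exists 1 => _ [A' [B' [sA' sB' ->]]].
have mA := sigma_coord_measurable _ _ sA'; have mB := sigma_coord_measurable _ _ sB'.
have p01 (C : set (env R)) : measurable C -> 0 <= fine (P C) <= 1.
  move=> mC; rewrite fine_ge0 //= -lee_fin fineK ?probability_le1 //.
  exact: fin_num_measure.
have /andP[a0 a1] := p01 _ mA; have /andP[b0 b1] := p01 _ mB.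
have /andP[c0 c1] := p01 _ (measurableI _ _ mA mB).
rewrite ler_norml; have := mulr_ge0 a0 b0; have := mulr_ile1 a0 b0 a1 b1.
by move=> ? ?; apply/andP; split; lra.
Qed.

Variables (l g : nat) (c : R).
Hypothesis l_gt0 : (0 < l)%N.
Let q k := fine (P (quiet_blocks l g c k 0)).
Let p := 1 - fine (P (quiet l c 0)).

(** By stationarity the blocks may be translated so that the first one ends at
site [0]; the others then start beyond site [g], and the mixing coefficient
measures the dependence. *)
Lemma quiet_blocks_rec k : q k.+1 <= (1 - p) * q k + mixing_coef P g.
Proof.
pose a : int := 1 - l%:Z.
have := @mixing_coef_ge g (quiet l c a) (quiet_blocks l g c k (a + (l + g)%N%:Z)).
have -> : P (quiet l c a) = P (quiet l c 0).
  by rewrite -!(quiet_blocks1 l g) quiet_blocks_shift.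
rewrite -quiet_blocksS !quiet_blocks_shift -/(q k) -/(q k.+1).
have -> : 1 - p = fine (P (quiet l c 0)) by rewrite /p; ring.
move=> h; rewrite addrC -lerBlDr; apply: (le_trans (ler_norm _)); apply: h.
  rewrite -(quiet_blocks1 l g); apply: sigma_coord_quiet_blocks => i j.
  by rewrite /a /= ltnS leqn0 => /eqP -> jl; lia.
by apply: sigma_coord_quiet_blocks => i j _ _; rewrite /a /=; lia.
Qed.

Lemma mixing_coef_ge0 n : 0 <= mixing_coef P n.
Proof.
have h0 (I : set int) : sigma_coord I (set0 : set (env R)) by exact: sigma_algebra0.
have := mixing_coef_ge n _ _ (h0 _) (h0 _).
by apply: le_trans; exact: normr_ge0.
Qed.

Lemma quiet_prob_bounds : 0 <= p <= 1.
Proof.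
have mQ : measurable (quiet l c 0 : set (env R)).
  by rewrite -(quiet_blocks1 l 0); exact: measurable_quiet_blocks_env.
have f1 : fine (P (quiet l c 0)) <= 1.
  by rewrite -lee_fin fineK ?probability_le1 //; exact: fin_num_measure.
have f0 : 0 <= fine (P (quiet l c 0)) by rewrite fine_ge0.
by rewrite /p; apply/andP; split; lra.
Qed.

Lemma quiet_blocks_geometric k : q k <= (1 - p) ^+ k + k%:R * mixing_coef P g.
Proof.
have /andP[p0 p1] := quiet_prob_bounds; have m0 := mixing_coef_ge0 g.
elim: k => [|k ih].
  rewrite mul0r addr0 expr0 /q -lee_fin fineK ?probability_le1 //.
    exact: measurable_quiet_blocks_env.
  by apply: fin_num_measure; exact: measurable_quiet_blocks_env.
apply: le_trans (quiet_blocks_rec k) _; rewrite exprS -natr1 [X in _ <= _ + X]mulrDl mul1r addrA lerD2r.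
have p1' : 0 <= 1 - p by lra.
apply: le_trans (ler_wpM2l p1' ih) _; rewrite mulrDr lerD2l ler_piMl //; last lra.
by rewrite mulr_ge0.
Qed.

Lemma quiet_blocks_le k : 0 < p -> (0 < k)%N ->
  q k <= (k%:R * p)^-1 + k%:R * mixing_coef P g.
Proof.
move=> p0 k0; have k0R : 0 < k%:R :> R by rewrite ltr0n.
apply: le_trans (quiet_blocks_geometric k) _; rewrite lerD2r.
have /andP[_ p1] := quiet_prob_bounds.
apply: (@le_trans _ _ (expR (- p) ^+ k)).
  by apply: lerXn2r; rewrite ?nnegrE ?expR_ge0 ?expR_ge1Dx //; lra.
rewrite -expRM_natr mulNr expRN lef_pV2 ?posrE ?expR_gt0 ?mulr_gt0 // mulrC.
by apply: le_trans (expR_ge1Dx _); rewrite lerDr.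
Qed.

End quiet_blocks.

(** * Fractional moments of sums of products *)

Section geometric_sums.
Context {R : realFieldType} (r : R).
Hypotheses (r0 : 0 < r) (r1 : r < 1).

Lemma sum_geometric_tail (a N : nat) :
  \sum_(t < N) (a <= t)%N%:R * r ^+ t <= r ^+ a / (1 - r).
Proof.
have s0 : 0 < 1 - r by rewrite subr_gt0.
apply: (@le_trans _ _ ((r ^+ a - r ^+ maxn a N) / (1 - r))); last first.
  by rewrite ler_pM2r ?invr_gt0 // gerBl exprn_ge0 // ltW.
elim: N => [|N ih]; first by rewrite big_ord0 maxn0 subrr mul0r.
rewrite big_ord_recr /=; have [aN|Na] := leqP a N.
  apply: le_trans (lerD ih (lexx _)) _.
  rewrite (maxn_idPr aN) (maxn_idPr (leqW aN)) mul1r exprS.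
  by rewrite [leLHS](_ : _ = (r ^+ a - r * r ^+ N) / (1 - r)) //; field; rewrite gt_eqF.
rewrite mul0r addr0; apply: le_trans ih _.
by rewrite (maxn_idPl (ltnW Na)) (maxn_idPl Na).
Qed.

Lemma sum_geometric (s N : nat) : \sum_(k < N) r ^+ (s + k) <= r ^+ s / (1 - r).
Proof.
have := sum_geometric_tail 0 N; rewrite expr0 => h.
under eq_bigr do rewrite exprD.
rewrite -mulr_sumr ler_pM2l ?exprn_gt0 // -div1r.
by apply: le_trans h; apply: ler_sum => k _; rewrite leq0n mul1r.
Qed.

Lemma sum_geometric_subn (b N : nat) :
  \sum_(j < N) r ^+ (j - b) <= b%:R + (1 - r)^-1.
Proof.
have s0 : 0 < 1 - r by rewrite subr_gt0.
have [Nb|bN] := leqP N b.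
  apply: (@le_trans _ _ (\sum_(j < N) 1)).
    by apply: ler_sum => j _; rewrite exprn_ile1 // ltW.
  by rewrite sumr_const card_ord ler_wpDr ?invr_ge0 ?(ltW s0) // ler_nat.
rewrite -(subnKC (ltnW bN)) big_split_ord /= lerD //.
  apply: (@le_trans _ _ (\sum_(j < b) 1)); last by rewrite sumr_const card_ord.
  by apply: ler_sum => j _; rewrite exprn_ile1 // ltW.
have := sum_geometric 0 (N - b); rewrite expr0 div1r.
by apply: le_trans; apply: ler_sum => j _; rewrite addKn add0n.
Qed.

End geometric_sums.

Section fractional_moments.
Context {R : realType} (P : probability (env R) R) (lam : R).
Hypotheses (lam0 : 0 < lam) (lam1 : lam <= 1).

(** Both [x / (x + y)] and [y / (x + y)] are at most [1], hence at most their
power of exponent [lam], and they add up to [1]. *)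
Lemma powRD_le (x y : R) : 0 <= x -> 0 <= y -> (x + y) `^ lam <= x `^ lam + y `^ lam.
Proof.
move=> x0 y0; have [s0|s0] := leP (x + y) 0.
  have -> : x + y = 0 by lra.
  by rewrite powR0 ?gt_eqF // addr_ge0 ?powR_ge0.
have frac u : 0 <= u -> u <= x + y -> u / (x + y) * (x + y) `^ lam <= u `^ lam.
  move=> u0 us; move: (u0); rewrite le_eqVlt => /predU1P[<-|u0'].
    by rewrite !mul0r powR_ge0.
  have {2}-> : u = u / (x + y) * (x + y) by rewrite divfK // gt_eqF.
  rewrite powRM ?divr_ge0 ?(ltW s0) // ler_pM2r ?powR_gt0 //.
  by apply: ger1_powR => //; rewrite divr_gt0 //= ler_pdivrMr // mul1r.
have hx : x <= x + y by lra.
have hy : y <= x + y by lra.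
apply: le_trans (lerD (frac x x0 hx) (frac y y0 hy)).
by rewrite -mulrDl -mulrDl divff ?gt_eqF // mul1r.
Qed.

Definition fmoment (f : env R -> R) : \bar R := (\int[P]_w (f w `^ lam)%:E)%E.

Lemma measurable_fun_powR (f : env R -> R) : measurable_fun setT f ->
  measurable_fun setT (fun w => (f w `^ lam)%:E).
Proof.
by move=> mf; apply/measurable_EFinP; exact: (measurableT_comp (measurable_powR lam)).
Qed.

Lemma fmomentD (f g : env R -> R) :
  measurable_fun setT f -> measurable_fun setT g ->
  (forall w, 0 <= f w) -> (forall w, 0 <= g w) ->
  (fmoment (fun w => f w + g w)%R <= fmoment f + fmoment g)%E.
Proof.
move=> mf mg f0 g0; rewrite /fmoment.
rewrite -ge0_integralD //; try exact: measurable_fun_powR;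
  try by move=> w _; rewrite lee_fin powR_ge0.
apply: ge0_le_integral => //.
- by move=> w _; rewrite lee_fin powR_ge0.
- by apply: measurable_fun_powR; exact: measurable_funD.
- by apply: emeasurable_funD; exact: measurable_fun_powR.
by move=> w _; rewrite -EFinD lee_fin powRD_le.
Qed.

Lemma fmomentZ c (f : env R -> R) : 0 <= c -> measurable_fun setT f ->
  (forall w, 0 <= f w) ->
  (fmoment (fun w => c * f w)%R = (c `^ lam)%:E * fmoment f)%E.
Proof.
move=> c0 mf f0; rewrite /fmoment -ge0_integralZl //.
- by apply: eq_integral => w _; rewrite powRM.
- exact: measurable_fun_powR.
- by move=> w _; rewrite lee_fin powR_ge0.
- by rewrite lee_fin powR_ge0.
Qed.

Lemma fmoment_sum N (f : nat -> env R -> R) :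
  (forall k, measurable_fun setT (f k)) -> (forall k w, 0 <= f k w) ->
  (fmoment (fun w => \sum_(k < N) f k w)%R <= \sum_(k < N) fmoment (f k))%E.
Proof.
move=> mf f0; elim: N => [|N ih].
  rewrite big_ord0 /fmoment; under eq_integral do rewrite big_ord0 powR0 ?gt_eqF //.
  by rewrite integral0.
rewrite big_ord_recr /=; apply: le_trans (leeD ih (lexx _)).
have -> : (fun w => \sum_(k < N.+1) f k w)%R =
    (fun w => \sum_(k < N) f k w + f N w)%R.
  by apply/funext => w; rewrite big_ord_recr.
apply: fmomentD => //; first by apply: measurable_sum => k; exact: mf.
by move=> w; rewrite sumr_ge0.
Qed.

Lemma fmoment_prodrho i n : stationary P ->
  fmoment (fun w => prodrho w i n) = moment P lam n.
Proof. exact: moment_shift. Qed.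

End fractional_moments.

Section flux_moments.
Context {R : realType}.

Lemma flux_prodrho (w : env R) (b : int) (n j : nat) : flux w b n j =
  \sum_(k < (n + j).+1) (k%:Z - n%:Z < b)%R%:R *
    (prodrho w (k%:Z - n%:Z + 1) (n + j - k) +
     prodrho w (k%:Z - n%:Z) (n + j - k).+1).
Proof.
rewrite flux_nat; apply: eq_bigr => k _; rewrite -mulrA; congr (_ * _).
have -> : j%:Z = k%:Z - n%:Z + (n + j - k)%N%:Z by have := ltn_ord k; lia.
rewrite weightD prodrhoSl; field.
by rewrite gt_eqF ?weight_gt0.
Qed.

Lemma measurable_flux b n (j : nat) : measurable_fun setT (fun w : env R => flux w b n j).
Proof.
under eq_fun do rewrite flux_prodrho.
apply: measurable_sum => k; apply: measurable_funM => //.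
by apply: measurable_funD; exact: measurable_prodrho.
Qed.

Context (P : probability (env R) R) (lam C r : R).
Hypotheses (sP : stationary P) (lam0 : 0 < lam) (lam1 : lam <= 1).
Hypotheses (C0 : 0 <= C) (r0 : 0 < r) (r1 : r < 1).
Hypothesis hC : forall n, (moment P lam n <= (C * r ^+ n)%:E)%E.

(** The terms of the flux at [j] are products over the sites from the sources, all
to the left of [b], to [j]; they have length at least [j - b], and the moments decay geometrically with the length.  The subtraction
is truncated, so for [j <= b] the bound is a constant. *)
Lemma fmoment_flux (b n j : nat) :
  (fmoment P lam (fun w => flux w b n j) <= (2 * C / (1 - r) * r ^+ (j - b))%:E)%E.
Proof.
pose f k (w : env R) := (k%:Z - n%:Z < b%:Z)%R%:R *
    (prodrho w (k%:Z - n%:Z + 1) (n + j - k) +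
     prodrho w (k%:Z - n%:Z) (n + j - k).+1).
have mp i m : measurable_fun setT (fun w : env R => prodrho w i m).
  exact: measurable_prodrho.
have p0 i m (w : env R) : 0 <= prodrho w i m by exact/ltW/prodrho_gt0.
have -> : (fun w => flux w b n j) = (fun w => \sum_(k < (n + j).+1) f k w).
  by apply/funext => w; rewrite flux_prodrho.
apply: le_trans (fmoment_sum _ _ lam0 lam1 _ f _ _) _.
- by move=> k; apply: measurable_funM => //; exact: measurable_funD.
- by move=> k w; rewrite mulr_ge0 // addr_ge0.
have term k : (fmoment P lam (f k) <=
    ((k%:Z - n%:Z < b%:Z)%R%:R * (2 * C * r ^+ (n + j - k)))%:E)%E.
  rewrite fmomentZ //; last first.
  - by move=> w; rewrite addr_ge0.
  - exact: measurable_funD.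
  case: (k%:Z - n%:Z < b%:Z)%R; last first.
    by rewrite powR0 ?gt_eqF // mul0e mul0r.
  rewrite powR1 mul1e mul1r; apply: le_trans (fmomentD _ _ lam0 lam1 _ _ _ _ _ _) _ => //.
  rewrite !fmoment_prodrho //; apply: le_trans (leeD (hC _) (hC _)) _.
  rewrite -EFinD lee_fin exprS.
  have : 0 <= C * r ^+ (n + j - k) by rewrite mulr_ge0 ?exprn_ge0 ?(ltW r0).
  have : 0 <= (1 - r) * (C * r ^+ (n + j - k)).
    by rewrite !mulr_ge0 ?exprn_ge0 ?(ltW r0) // subr_ge0 ltW.
  lra.
apply: (@le_trans _ _ (\sum_(k < (n + j).+1)
    ((k%:Z - n%:Z < b%:Z)%R%:R * (2 * C * r ^+ (n + j - k)))%:E)%E).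
  by apply: lee_sum => k _; exact: term.
rewrite sumEFin lee_fin.
under eq_bigr => k _ do rewrite mulrCA.
rewrite -mulr_sumr -[leRHS]mulrA ler_wpM2l ?mulr_ge0 // mulrC.
apply: le_trans (sum_geometric_tail r r0 r1 (j - b) (n + j).+1).
rewrite (reindex_inj rev_ord_inj) /=; apply: ler_sum => t _.
rewrite subSS subKn; last by rewrite -ltnS.
rewrite ler_wpM2r ?exprn_ge0 ?(ltW r0) // ler_nat.
have tn := ltn_ord t.
case: (boolP ((n + j - t)%N%:Z - n%:Z < b%:Z)%R) => // h.
by have -> : (j - b <= t)%N by lia.
Qed.

End flux_moments.

(** * Annealed bounds *)

Section annealed_bounds.
Context {R : realType} (P : probability (env R) R)
  (Pq : env R -> probability path_space R)
  (PP : probability (env R * path_space)%type R).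
Hypotheses (sP : stationary P) (hq : forall w, is_quenched_law w (Pq w))
  (hA : is_annealed_law P Pq PP).

(** The dependence of the quenched law on the environment is only known through an
inequality, so its measurability is not at hand.  The integral of a nonnegative
function, a supremum over the simple functions below it, is monotone anyway. *)
Lemma le_integral_ge0 d (T : measurableType d) (mu : probability T R) (f h : T -> \bar R) :
  (forall t, (0 <= f t)%E) -> (forall t, (f t <= h t)%E) ->
  (\int[mu]_t f t <= \int[mu]_t h t)%E.
Proof.
move=> f0 fh; have h0 t : (0 <= h t)%E by exact: le_trans (f0 t) (fh t).
rewrite !ge0_integralTE //; apply: ereal_sup_le => _ [s /= sf <-].
by exists s => // t; exact: le_trans (sf t) (fh t).
Qed.

Lemma measurable_annealed_event n (S : pred int) :
  measurable [set z : env R * path_space | S (z.2 n)].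
Proof.
have -> : [set z : env R * path_space | S (z.2 n)] =
    setT `*` [set X : path_space | S (X n)].
  by apply/seteqP; split=> z //= [].
by apply: measurableX => //; exact: (measurable_path_event n [set x | S x]).
Qed.

Lemma annealed_le n (S : pred int) (b : env R -> R) :
  (forall w, iter n (step w) (fun x => (S x)%:R) 0 <= b w) ->
  (PP [set z | S (z.2 n)] <= \int[P]_w (b w)%:E)%E.
Proof.
move=> hb.
have -> : [set z : env R * path_space | S (z.2 n)] =
    setT `*` [set X : path_space | S (X n)].
  by apply/seteqP; split=> z //= [].
rewrite hA //; last exact: (measurable_path_event n [set x | S x]).
apply: le_integral_ge0 => w; first exact: measure_ge0.
by apply: le_trans (quenched_marginal_le w _ (hq w) n S) _; rewrite lee_fin.
Qed.

Lemma iter_step_le1 (w : env R) n (S : pred int) :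
  iter n (step w) (fun x => (S x)%:R) 0 <= 1.
Proof.
apply: (@le_trans _ _ (iter n (step w) (fun=> 1) 0)).
  by apply: iter_step_le => y _; case: (S y).
by rewrite iter_step_cst.
Qed.

Lemma min1_le_powR (lam u : R) : 0 < lam -> lam <= 1 -> 0 <= u ->
  Num.min 1 u <= u `^ lam.
Proof.
move=> lam0 lam1; rewrite le_eqVlt => /predU1P[<-|u0].
  by rewrite powR0 ?gt_eqF // ge_min lexx orbT.
have [u1|u1] := leP u 1.
  by apply: ger1_powR => //; rewrite u0.
by rewrite -[leLHS](powRr0 u); apply: ler_powR; exact: ltW.
Qed.

(** Unless all [k] blocks are quiet, there is a trap of depth [c] before site
[k * (l + g)]. *)
Lemma annealed_right_bound (k l g n : nat) (c : R) :
  let p := 1 - fine (P (quiet l c 0)) in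
  (0 < l)%N -> (0 < k)%N -> 0 < p ->
  (PP [set z | ((k * (l + g))%N%:Z < z.2 n)%R] <=
    ((k%:R * p)^-1 + k%:R * mixing_coef P g + n%:R / expR c)%:E)%E.
Proof.
move=> p l0 k0 p0.
pose Q := quiet_blocks l g c k (1 : int) : set (env R).
have mQ : measurable Q by exact: measurable_quiet_blocks_env.
pose b (w : env R) := \1_Q w + n%:R / expR c.
have := @annealed_le n (fun x => ((k * (l + g))%N%:Z < x)%R) b.
move=> h; apply: le_trans (h _) _ => [w|].
  rewrite /b indicE; have [wQ|/negP wQ] := boolP (w \in Q).
    apply: le_trans (iter_step_le1 w n _) _.
    by rewrite lerDl divr_ge0 // expR_ge0.
  have [i ik hi] : exists2 i, (i < k)%N &
      c <= \sum_(0 <= j < l) ln (rho w (1 + (i * (l + g))%N%:Z + j%:Z)).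
    apply: contrapT => hn; apply: wQ; apply/mem_set => i ik.
    by rewrite /quiet /= ltNge; apply/negP => hc; apply: hn; exists i.
  rewrite add0r.
  apply: le_trans (quenched_trap_bound w (i * (l + g)) l n (expR c) _ _).
  - apply: iter_step_le => y _; rewrite ler_nat.
    case: (ltP (k * (l + g))%N%:Z y) => // ky.
    have : (i.+1 * (l + g) <= k * (l + g))%N by rewrite leq_mul2r ik orbT.
    rewrite mulSn => h2.
    by have -> : ((i * (l + g))%N%:Z + l%:Z < y)%R = true by lia.
  - exact: expR_gt0.
  - by rewrite prodrhoE ler_expR [_ + 1]addrC.
rewrite /b; under eq_integral do rewrite EFinD.
rewrite ge0_integralD //.
- rewrite integral_indic // setIT integral_cst //= probability_setT mule1.
  rewrite EFinD leeD2r // /Q quiet_blocks_shift //.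
  rewrite -[X in (X <= _)%E]fineK ?lee_fin; first exact: quiet_blocks_le.
- by apply: fin_num_measure; exact: measurable_quiet_blocks_env.
- by apply/measurable_EFinP; exact: measurable_indic.
Qed.

Context (lam C r : R).
Hypotheses (lam0 : 0 < lam) (lam1 : lam <= 1).
Hypotheses (C0 : 0 <= C) (r0 : 0 < r) (r1 : r < 1).
Hypothesis hC : forall n, (moment P lam n <= (C * r ^+ n)%:E)%E.

Let mp i m : measurable_fun setT (fun w : env R => prodrho w i m).
Proof. exact: measurable_prodrho. Qed.

Let p0 i m (w : env R) : 0 <= prodrho w i m.
Proof. exact/ltW/prodrho_gt0. Qed.

Lemma fmoment_sum_prodrho i s N :
  (fmoment P lam (fun w => \sum_(k < N) prodrho w i (s + k))%R <=
   (C / (1 - r) * r ^+ s)%:E)%E.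
Proof.
apply: le_trans (fmoment_sum P lam lam0 lam1 N (fun k w => prodrho w i (s + k)) _ _) _ => //.
apply: (@le_trans _ _ (\sum_(k < N) (C * r ^+ (s + k))%:E)%E).
  by apply: lee_sum => k _; rewrite fmoment_prodrho.
rewrite sumEFin lee_fin -mulr_sumr -mulrA ler_wpM2l // mulrC.
exact: sum_geometric.
Qed.

Lemma annealed_left_bound (s n : nat) :
  (PP [set z | (z.2 n <= - s%:Z)%R] <= (C / (1 - r) * r ^+ s)%:E)%E.
Proof.
apply: le_trans (fmoment_sum_prodrho (- s%:Z + 1) s n.+1).
apply: (@annealed_le n (fun x => (x <= - s%:Z)%R)) => w.
set u := \sum_(k < n.+1) _.
have u0 : 0 <= u by apply: sumr_ge0 => k _; exact: p0.
apply: le_trans (min1_le_powR lam u lam0 lam1 u0).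
by rewrite le_min iter_step_le1 /=; exact: quenched_left_bound.
Qed.

Lemma annealed_slow_bound (m n : nat) : (0 < n)%N ->
  (PP [set z | (z.2 n <= m%:Z)%R] <=
    (n%:R^-1 `^ lam * (2 * C / (1 - r) * ((m + m)%:R + (1 - r)^-1)) +
     C / (1 - r) * r ^+ m)%:E)%E.
Proof.
move=> n0; have n0R : 0 < n%:R :> R by rewrite ltr0n.
pose G (w : env R) := \sum_(j < n.+1) flux w (m + m)%N%:Z n j.
pose F (w : env R) := \sum_(k < n.+1) prodrho w (m%:Z + 1) (m + k).
have mG : measurable_fun setT G by apply: measurable_sum => j; exact: measurable_flux.
have mF : measurable_fun setT F by apply: measurable_sum => k; exact: mp.
have fl0 (w : env R) (j : nat) : 0 <= flux w (m + m)%N%:Z n j.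
  by apply: flux_ge0; lia.
have G0 w : 0 <= G w by apply: sumr_ge0 => j _; exact: fl0.
have F0 w : 0 <= F w by apply: sumr_ge0 => k _; exact: p0.
have nG0 w : 0 <= n%:R^-1 * G w by rewrite mulr_ge0 // invr_ge0 ltW.
apply: (@le_trans _ _ (fmoment P lam (fun w => n%:R^-1 * G w + F w)%R)).
  apply: (@annealed_le n (fun x => (x <= m%:Z)%R)) => w.
  apply: le_trans (min1_le_powR lam _ lam0 lam1 _); last by rewrite addr_ge0.
  rewrite le_min iter_step_le1 /= -(ler_pM2l n0R) mulrDr mulVKf ?gt_eqF //.
  exact: quenched_slow_bound.
apply: le_trans (fmomentD _ _ lam0 lam1 _ _ _ _ _ _) _ => //.
  exact: measurable_funM.
rewrite EFinD; apply: leeD; last exact: fmoment_sum_prodrho.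
rewrite fmomentZ // ?invr_ge0 ?(ltW n0R) // EFinM.
apply: lee_wpmul2l; first by rewrite lee_fin powR_ge0.
apply: le_trans (fmoment_sum P lam lam0 lam1 n.+1
  (fun j w => flux w (m + m)%N%:Z n j) _ _) _ => //.
  by move=> j; exact: measurable_flux.
apply: (@le_trans _ _ (\sum_(j < n.+1)
    (2 * C / (1 - r) * r ^+ (j - (m + m)))%:E)%E).
  by apply: lee_sum => j _; exact: fmoment_flux.
rewrite sumEFin lee_fin -mulr_sumr ler_wpM2l ?sum_geometric_subn //.
by rewrite divr_ge0 ?mulr_ge0 // subr_ge0 ltW.
Qed.

End annealed_bounds.

(** * Asymptotics *)

Section asymptotics.
Context {R : realType}.

Lemma powR_nat_ge (a A : R) : 0 < a -> \forall n \near \oo, A <= n%:R `^ a.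
Proof.
move=> a0; near=> n.
pose B := Num.max A 1.
have B0 : 0 < B by rewrite lt_max ltr01 orbT.
have nB : B `^ a^-1 <= n%:R by near: n; exact: nbhs_infty_ger.
apply: (@le_trans _ _ B); first by rewrite le_max lexx.
have {1}-> : B = (B `^ a^-1) `^ a.
  by rewrite -powRrM mulVf ?gt_eqF // powRr1 // ltW.
by apply: ge0_ler_powR => //; rewrite ?nnegrE ?powR_ge0 // ltW.
Unshelve. all: by end_near. Qed.

Lemma le_absorb (D x e : R) : 0 <= D -> 0 <= x -> x <= e / (D + 1) -> D * x <= e.
Proof.
move=> D0 x0; rewrite ler_pdivlMr; last by rewrite ltr_wpDl.
by apply: le_trans; rewrite mulrDr mulr1 mulrC lerDl.
Qed.

Lemma geometric_nat_le (r B e b : R) : 0 < r -> r < 1 -> 0 < b -> 0 < e -> 0 < B ->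
  \forall n \near \oo, forall m : nat, B * n%:R `^ b <= m.+1%:R -> r ^+ m <= e.
Proof.
move=> r0 r1 b0 e0 B0.
have : (fun m => r ^+ m) @ \oo --> (0 : R).
  by apply: cvg_expr; rewrite ger0_norm // ltW.
move=> /cvgrPdist_le/(_ e e0)[m0 _ hm0].
near=> n => m nm.
have h : (m0.+1%:R) / B <= n%:R `^ b by near: n; exact: powR_nat_ge.
have mm : (m0 <= m)%N.
  rewrite -ltnS -(ler_nat R); apply: le_trans nm.
  by rewrite mulrC -ler_pdivrMr.
by have := hm0 m mm; rewrite sub0r normrN ger0_norm // exprn_ge0 // ltW.
Unshelve. all: by end_near. Qed.

Lemma cvge0_near (u : nat -> \bar R) : (forall n, (0 <= u n)%E) ->
  (forall e : R, 0 < e -> \forall n \near \oo, (u n <= e%:E)%E) ->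
  u @ \oo --> 0%E.
Proof.
move=> u0 ue; apply: cvg_EFin.
  have := ue 1 ltr01; apply: filterS => n un.
  by rewrite ge0_fin_numE // (le_lt_trans un) // ltry.
apply/cvgrPdist_le => e e0; have := ue e e0; apply: filterS => n un /=.
have uf : u n \is a fin_num by rewrite ge0_fin_numE // (le_lt_trans un) // ltry.
by rewrite sub0r normrN ger0_norm ?fine_ge0 // -lee_fin fineK.
Qed.

Context (P : probability (env R) R) (J : R -> \bar R).

Lemma mixing_decay (xi : R) : condA1 P -> 0 < xi ->
  \forall n \near \oo, mixing_coef P n <= (n%:R `^ xi)^-1.
Proof.
move=> A1 xi0; have := A1 xi xi0.
rewrite (_ : (fun n => _) = series (fun k => k%:R `^ xi * mixing_coef P k)).
  move=> /cvg_series_cvg_0/cvgrPdist_le/(_ 1 ltr01) h; near=> n.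
  have n0 : (0 < n)%N by near: n; exists 1%N.
  have nx : 0 < n%:R `^ xi by rewrite powR_gt0 // ltr0n.
  have : `|0 - n%:R `^ xi * mixing_coef P n| <= 1 by near: n.
  rewrite sub0r normrN => h1; rewrite -div1r ler_pdivlMr // mulrC.
  exact: le_trans (ler_norm _) h1.
apply/funext => -[|n]; first by rewrite /series /= !big_geq.
by rewrite /series /= [RHS]big_ltn // powR0 ?gt_eqF // mul0r add0r.
Unshelve. all: by end_near. Qed.

(** The lower large deviation bound on the half-line right of [y'].  It is
uniform in the depth [c] below [l * y'], because [c] is fixed before the length
[l] is rounded to an integer. *)
Lemma trap_probability (y y' v dl : R) : condA2 P J ->
  y' < y -> (J y <= v%:E)%E -> 0 < dl ->
  \forall l \near \oo, forall c, c <= l%:R * y' ->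
    expR (l%:R * - (v + dl)) <= 1 - fine (P (quiet l c 0)).
Proof.
move=> A2 yy Jv dl0.
pose A : set R := `]y', +oo[%classic.
have mA : measurable A by exact: measurable_itv.
have Ay : A° y.
  have -> : A° = A by apply/interior_id; exact: interval_open.
  by rewrite /A /= in_itv /= andbT.
have low : ((- (v + dl))%:E <
    limn_einf (fun n => n%:R^-1%:E * lne (P (@mean_log_rho R n @^-1` A))))%E.
  case: A2 => _ _ /(_ A mA) + _; apply: lt_le_trans.
  rewrite EFinN lteN2; apply: (@le_lt_trans _ _ (J y)).
    by apply: ereal_inf_lbound; exists y.
  by apply: le_lt_trans Jv _; rewrite lte_fin; lra.
have /limn_einf_gt n1 := low; near=> l => c cl.
have l0 : (0 < l)%N by near: l; exists 1%N.
have l0R : 0 < l%:R :> R by rewrite ltr0n.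
have h1 : ((expR (l%:R * - (v + dl)))%:E <= P (@mean_log_rho R l @^-1` A))%E.
  by apply: lne_rate_gt => //; near: l.
have mV : measurable (@mean_log_rho R l @^-1` A) by exact: measurable_mean_preimage.
have mQ : measurable (quiet l c 0 : set (env R)).
  by rewrite -(quiet_blocks1 l 0); exact: measurable_quiet_blocks_env.
have Qf : P (quiet l c 0) \is a fin_num by exact: fin_num_measure.
rewrite -lee_fin; apply: le_trans h1 _.
rewrite EFinB fineK // -probability_setC //.
apply: le_measure; rewrite ?inE //; first exact: measurableC.
move=> w; rewrite /A /= in_itv /= andbT /mean_log_rho => hV.
rewrite /quiet /=; apply/negP; rewrite -leNgt.
apply: le_trans cl _; under eq_bigr do rewrite add0r.
by rewrite -ler_pdivlMl // ltW.
Unshelve. all: by end_near. Qed.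

End asymptotics.

Section limits.
Context {R : realType} (P : probability (env R) R) (J : R -> \bar R)
  (Pq : env R -> probability path_space R)
  (PP : probability (env R * path_space)%type R).
Hypotheses (sP : stationary P) (hq : forall w, is_quenched_law w (Pq w))
  (hA : is_annealed_law P Pq PP).
Hypotheses (A1 : condA1 P) (A2 : condA2 P J) (A3 : condA3 P) (A4 : condA4 P).

Lemma kappa_fin : kappa J = (fine (kappa J))%:E.
Proof.
rewrite fineK // ge0_fin_numE; last exact: ltW (kappa_gt0 _ _ A2 A4).
by rewrite (le_lt_trans (kappa_le1 _ _ A2 A3 A4)) // ltry.
Qed.

Let k := fine (kappa J).

Let k0 : 0 < k.
Proof. by rewrite -lte_fin -kappa_fin (kappa_gt0 _ _ A2 A4). Qed.

Let k1 : k <= 1.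
Proof. by rewrite -lee_fin -kappa_fin (kappa_le1 _ _ A2 A3 A4). Qed.

(** With an exponent [lam] strictly between [b] and [kappa], the bound
is of order [n ^ (b - lam)]. *)
Lemma slow_vanishes (b e : R) : 0 < b -> b < k -> 0 < e ->
  \forall n \near \oo,
    (PP [set z | (z.2 n <= (Num.trunc (n%:R `^ b)).+1%:Z)%R] <= e%:E)%E.
Proof.
move=> b0 bk e0; pose lam := (b + k) / 2.
have lam0 : 0 < lam by rewrite /lam; lra.
have lam1 : lam <= 1 by have := k1; rewrite /lam; lra.
have lamk : (lam%:E < kappa J)%E by rewrite kappa_fin lte_fin -/k /lam; lra.
have [C [r [C0 r0 r1 hC]]] := moment_geometric_kappa _ _ sP A2 A3 A4 _ lam0 lamk.
have s0 : 0 < 1 - r by rewrite subr_gt0.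
have [D' D0' DE'] : exists2 D', 0 <= D' & C / (1 - r) = D'.
  by exists (C / (1 - r)) => //; rewrite divr_ge0 // ltW.
have i0 : 0 <= (1 - r)^-1 by rewrite invr_ge0 ltW.
have [D D0 DE] : exists2 D, 0 <= D & 2 * C / (1 - r) = D.
  by exists (2 * C / (1 - r)) => //; rewrite divr_ge0 ?mulr_ge0 // ltW.
have [E E0 EE] : exists2 E, 0 <= E & D * (4 + (1 - r)^-1) = E.
  by exists (D * (4 + (1 - r)^-1)) => //; rewrite mulr_ge0 // addr_ge0.
near=> n.
have n0 : (0 < n)%N by near: n; exists 1%N.
have n0R : 0 < n%:R :> R by rewrite ltr0n.
set m := (Num.trunc (n%:R `^ b)).+1.
apply: le_trans (annealed_slow_bound P Pq PP sP hq hA lam C r lam0 lam1 C0 r0 r1 hC m n n0) _.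
rewrite DE DE' lee_fin.
have x0 : 0 <= n%:R `^ b by exact: powR_ge0.
have x1 : 1 <= n%:R `^ b by near: n; exact: powR_nat_ge.
have /andP[mx1 mx2] := truncn_itv x0; rewrite -/m in mx2.
have mx3 : m%:R <= n%:R `^ b + 1 by rewrite /m -natr1 lerD2r.
clearbody m.
have rm : r ^+ m <= e / 2 / (D' + 1).
  have h : 1 * n%:R `^ b <= m.+1%:R by rewrite mul1r -natr1 ler_wpDr // ltW.
  move: (m) h; near: n; apply: geometric_nat_le => //.
  by rewrite !divr_gt0 // ltr_wpDl.
have t1 : D' * r ^+ m <= e / 2 by apply: le_absorb => //; rewrite exprn_ge0 // ltW.
have big : 2 * (E + 1) / e <= n%:R `^ (lam - b).
  by near: n; apply: powR_nat_ge; rewrite /lam; lra.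
have t2 : n%:R^-1 `^ lam * (D * ((m + m)%:R + (1 - r)^-1)) <= e / 2.
  apply: (@le_trans _ _ (n%:R^-1 `^ lam * (E * n%:R `^ b))).
    rewrite ler_wpM2l ?powR_ge0 // -EE -mulrA ler_wpM2l // natrD.
    have := ler_wpM2l i0 x1; lra.
  have -> : n%:R^-1 `^ lam = (n%:R `^ (lam - b))^-1 * (n%:R `^ b)^-1.
    rewrite -invfM -powRD; last by rewrite (gt_eqF n0R) implybT.
    by rewrite subrK -(powR_inv1 (ltW n0R)) -powRrM mulN1r powRN.
  have nl : 0 < n%:R `^ (lam - b) by exact: powR_gt0.
  rewrite [leLHS](_ : _ = E / n%:R `^ (lam - b)); last first.
    by field; rewrite !gt_eqF // powR_gt0.
  rewrite ler_pdivrMr //; move: big; rewrite ler_pdivrMr //; lra.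
lra.
Unshelve. all: by end_near. Qed.

Lemma left_vanishes (a B e : R) : 0 < a -> 0 < B -> 0 < e ->
  \forall n \near \oo,
    (PP [set z | (z.2 n <= - (Num.trunc (B * n%:R `^ a))%:Z)%R] <= e%:E)%E.
Proof.
move=> a0 B0 e0; pose lam := k / 2.
have lam0 : 0 < lam by rewrite /lam divr_gt0.
have lam1 : lam <= 1 by have := k1; rewrite /lam; lra.
have lamk : (lam%:E < kappa J)%E by rewrite kappa_fin lte_fin -/k /lam; have := k0; lra.
have [C [r [C0 r0 r1 hC]]] := moment_geometric_kappa _ _ sP A2 A3 A4 _ lam0 lamk.
have s0 : 0 < 1 - r by rewrite subr_gt0.
have [D' D0' DE'] : exists2 D', 0 <= D' & C / (1 - r) = D'.
  by exists (C / (1 - r)) => //; rewrite divr_ge0 // ltW.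
near=> n; set s := Num.trunc _.
apply: le_trans (annealed_left_bound P Pq PP sP hq hA lam C r lam0 lam1 C0 r0 r1 hC s n) _.
rewrite DE' lee_fin.
have x0 : 0 <= B * n%:R `^ a by rewrite mulr_ge0 ?powR_ge0 // ltW.
have /andP[_ sx2] := truncn_itv x0; rewrite -/s in sx2.
clearbody s.
have rm : r ^+ s <= e / (D' + 1).
  move: (s) (ltW sx2); near: n; apply: geometric_nat_le => //.
  by rewrite divr_gt0 // ltr_wpDl.
by apply: le_absorb => //; rewrite exprn_ge0 // ltW.
Unshelve. all: by end_near. Qed.

End limits.

(** * Traps stop the walk before n ^ a when a > kappa *)

Section right_limit.
Context {R : realType} (P : probability (env R) R) (J : R -> \bar R)
  (Pq : env R -> probability path_space R)
  (PP : probability (env R * path_space)%type R).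
Hypotheses (sP : stationary P) (hq : forall w, is_quenched_law w (Pq w))
  (hA : is_annealed_law P Pq PP).
Hypotheses (A1 : condA1 P) (A2 : condA2 P J) (A3 : condA3 P) (A4 : condA4 P).

Lemma annealed_event_le n (S T : pred int) : (forall x, S x -> T x) ->
  (PP [set z | S (z.2 n)] <= PP [set z | T (z.2 n)])%E.
Proof.
move=> ST; apply: le_measure; rewrite ?inE; try exact: measurable_annealed_event.
by move=> z /= /ST.
Qed.

(** The arithmetic of [right_vanishes], with [d = a - kappa], [t = n ^ (d / 4)] and
[K = n ^ kappa], so that [n ^ a = K * t ^ 4].  There are [N] of order
[K * t ^ 2] blocks, each a trap with probability [p] at least of order
[1 / (K * t)]; their length [l + g] is of order [t], so that they fit into
[B * n ^ a], and the mixing error [N * eta] is at most [t ^ (- 2)]. *)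
Lemma block_count_estimate (K t B e c1 p eta h M l g : R) (N : nat) :
  0 < K -> 0 < c1 -> 0 < e -> 1 <= t -> 2 <= K * t ^+ 2 ->
  N%:R <= K * t ^+ 2 -> K * t ^+ 2 < N.+1%:R ->
  c1 / (K * t) <= p -> eta <= (K * t ^+ 4)^-1 -> 0 <= eta -> h <= e / 3 ->
  6 / (c1 * e) <= t -> 3 / e <= t ->
  l + g <= M * t + 3 * t -> 0 <= l + g -> (M + 3) / B <= t -> 0 < B ->
  [/\ (0 < N)%N, 0 < p, N%:R * (l + g) <= B * (K * t ^+ 4) &
      (N%:R * p)^-1 + N%:R * eta + h <= e].
Proof.
move=> K0 c10 e0 t1 Kt2 N1 N2 hp heta eta0 hh ht1 ht2 hlg lg0 hM B0.
have t0 : 0 < t by exact: lt_le_trans t1.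
have Kt0 : 0 < K * t by exact: mulr_gt0.
have p0 : 0 < p by apply: lt_le_trans hp; rewrite divr_gt0.
have N3 : K * t ^+ 2 / 2 <= N%:R by move: N2; rewrite -natr1; lra.
have N0 : 0 < N%:R :> R by apply: lt_le_trans N3; lra.
split => //; first by rewrite -(ltr_nat R).
  have h1 : M * t + 3 * t <= B * t * t.
    rewrite -mulrDl ler_pM2r //; move: hM; rewrite ler_pdivrMr //; lra.
  apply: (@le_trans _ _ (K * t ^+ 2 * (B * t * t))).
    by apply: ler_pM => //; exact: le_trans hlg h1.
  by rewrite le_eqVlt; apply/orP; left; apply/eqP; ring.
have Np : c1 * t / 2 <= N%:R * p.
  apply: (@le_trans _ _ (K * t ^+ 2 / 2 * (c1 / (K * t)))).
    by rewrite le_eqVlt; apply/orP; left; apply/eqP; field; rewrite !gt_eqF.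
  apply: ler_pM => //; first by rewrite divr_ge0 // ltW //; lra.
  by rewrite divr_ge0 // ltW.
have Np0 : 0 < c1 * t / 2 by rewrite divr_gt0 // mulr_gt0.
have b1 : (N%:R * p)^-1 <= e / 3.
  apply: (@le_trans _ _ (c1 * t / 2)^-1).
    by rewrite lef_pV2 ?posrE // mulr_gt0.
  move: ht1; rewrite ler_pdivrMr ?mulr_gt0 // => ht1.
  rewrite -[leLHS]mul1r ler_pdivrMr //; lra.
have b2 : N%:R * eta <= e / 3.
  apply: (@le_trans _ _ (K * t ^+ 2 * (K * t ^+ 4)^-1)).
    by apply: ler_pM.
  rewrite [leLHS](_ : _ = (t ^+ 2)^-1); last by field; rewrite !gt_eqF.
  apply: (@le_trans _ _ t^-1).
    by rewrite lef_pV2 ?posrE ?exprn_gt0 // expr2 ler_peMl // ltW.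
  move: ht2; rewrite ler_pdivrMr // => ht2.
  rewrite -[leLHS]mul1r ler_pdivrMr //; lra.
lra.
Qed.

(** Traps of depth [c = (1 + tau) * ln n] resist [n] steps.  The slope
[y' = y / (1 + tau)] below the minimizer [y], the excess depth and the loss
[k * y * tau] in the large deviation bound each cost a factor [1 + tau] in the
exponent [kappa] of the trap probability, which [d / 4] absorbs. *)
Lemma right_vanishes (a B e : R) : (kappa J < a%:E)%E -> 0 < B -> 0 < e ->
  \forall n \near \oo,
    (PP [set z | (B * n%:R `^ a < (z.2 n)%:~R)%R] <= e%:E)%E.
Proof.
move=> ka B0 e0; have kE := kappa_fin _ _ A2 A3 A4.
have [y y0 hy] := kappa_attained _ _ A2 A3 A4.
have k0 : 0 < fine (kappa J) by rewrite -lte_fin -kE (kappa_gt0 _ _ A2 A4).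
have k1 : fine (kappa J) <= 1 by rewrite -lee_fin -kE (kappa_le1 _ _ A2 A3 A4).
rewrite kE lte_fin in ka; rewrite kE in hy.
move: (fine (kappa J)) k0 k1 ka hy => k k0 k1 ka hy {kE}.
have Jy : (J y <= (k * y)%:E)%E.
  move: hy; rewrite /rate_ratio; have := rate_ge0 _ _ A2 y.
  case: (J y) => [j| |] // _; last by rewrite mulyr gtr0_sg ?invr_gt0 // mul1e.
  by rewrite -EFinM => -[<-]; rewrite divfK // gt_eqF.
pose d := a - k; have d0 : 0 < d by rewrite subr_gt0.
have [tau [tau0 tau1 tauk]] : exists tau, [/\ 0 < tau, tau <= 1 &
    k * (1 + tau) ^+ 3 <= k + d / 4].
  (* [28 = 7 * 4], as [(1 + tau) ^ 3 <= 1 + 7 * tau] for [tau <= 1]. *)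
  pose tau := Num.min 1 (d / 28).
  have tau0 : 0 < tau by rewrite lt_min ltr01 divr_gt0.
  have tau1 : tau <= 1 by rewrite ge_min lexx.
  have tau2 : tau <= d / 28 by rewrite ge_min lexx orbT.
  exists tau; split => //; clearbody tau; clearbody d.
  have t2 : tau * tau <= tau by rewrite ler_piMl // ltW.
  have t3 : tau * tau * tau <= tau.
    by apply: le_trans t2; rewrite ler_piMr // mulr_ge0 // ltW.
  have c3 : (1 + tau) ^+ 3 <= 1 + 7 * tau.
    rewrite [leLHS](_ : _ = 1 + 3 * tau + 3 * (tau * tau) + tau * tau * tau).
      lra.
    by ring.
  apply: le_trans (ler_wpM2l (ltW k0) c3) _; rewrite mulrDr mulr1 lerD2l.
  apply: (@le_trans _ _ (7 * tau)); last by lra.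
  by rewrite ler_piMl // mulr_ge0 // ltW.
have u0 : 0 < 1 + tau by exact: addr_gt0.
have [y' y'0 y'E] : exists2 y', 0 < y' & y = y' * (1 + tau).
  by exists (y / (1 + tau)); [rewrite divr_gt0 | rewrite divfK // gt_eqF].
have yy : y' < y by rewrite y'E ltr_pMr // ltrDl.
have dl0 : 0 < k * y * tau by rewrite !mulr_gt0.
have [l0 _ hl0] := trap_probability P J y y' _ _ A2 yy Jy dl0.
(* With this exponent [t ^ xi = n ^ a], where [t = n ^ (d / 4)]. *)
pose xi := (k + d) / (d / 4).
have xi0 : 0 < xi by rewrite divr_gt0 ?divr_gt0 // addr_gt0.
have [g0 _ hg0] := mixing_decay P xi A1 xi0.
have [c1 c10 c1E] : exists2 c1, 0 < c1 & expR (- (k * y * (1 + tau))) = c1.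
  by exists (expR (- (k * y * (1 + tau)))) => //; exact: expR_gt0.
have [M M0 ME] : exists2 M, 0 <= M & (1 + tau) / y' / (d / 4) = M.
  exists ((1 + tau) / y' / (d / 4)) => //.
  by rewrite !divr_ge0 // ltW.
have pow_ge b A : 0 < b -> \forall n \near \oo, A <= expR (b * ln (n%:R : R)).
  move=> b0; near=> n; have n0 : (0 < n)%N by near: n; exists 1%N.
  have -> : expR (b * ln (n%:R : R)) = n%:R `^ b.
    by rewrite /powR gt_eqF // ltr0n.
  by near: n; exact: powR_nat_ge.
have d40 : 0 < d / 4 by rewrite divr_gt0.
near=> n.
have n0 : (0 < n)%N by near: n; exists 1%N.
have n0R : 0 < n%:R :> R by rewrite ltr0n.
have bt1 : 1 <= expR (d / 4 * ln (n%:R : R)) by near: n; exact: pow_ge.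
have bt2 : 6 / (c1 * e) <= expR (d / 4 * ln (n%:R : R)) by near: n; exact: pow_ge.
have bt3 : 3 / e <= expR (d / 4 * ln (n%:R : R)) by near: n; exact: pow_ge.
have bt4 : (M + 3) / B <= expR (d / 4 * ln (n%:R : R)) by near: n; exact: pow_ge.
have bt5 : g0%:R <= expR (d / 4 * ln (n%:R : R)) by near: n; exact: pow_ge.
have bt6 : 2 <= expR (d / 4 * ln (n%:R : R)) by near: n; exact: pow_ge.
have btau : 3 / e <= expR (tau * ln (n%:R : R)) by near: n; exact: pow_ge.
have bl : expR (l0%:R * y' / (1 + tau)) <= n%:R by near: n; exact: nbhs_infty_ger.
have nL : expR (ln (n%:R : R)) = n%:R by rewrite lnK // posrE.
have n1 : 1 <= n%:R :> R by rewrite ler1n.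
have L0 : 0 <= ln (n%:R : R) by rewrite ln_ge0.
have na : n%:R `^ a = expR (a * ln (n%:R : R)) by rewrite /powR gt_eqF.
move: (ln (n%:R : R)) na nL L0 bt1 bt2 bt3 bt4 bt5 bt6 btau => L na nL L0.
have [t t0 tE] : exists2 t, 0 < t & expR (d / 4 * L) = t.
  by exists (expR (d / 4 * L)) => //; exact: expR_gt0.
have [K K0 KE] : exists2 K, 0 < K & expR (k * L) = K.
  by exists (expR (k * L)) => //; exact: expR_gt0.
rewrite tE => bt1 bt2 bt3 bt4 bt5 bt6 btau.
have Kta : n%:R `^ a = K * t ^+ 4.
  by rewrite na -tE -KE -expRM_natr -expRD; congr expR; rewrite /d; field.
have K1 : 1 <= K by rewrite -KE -expR0 ler_expR mulr_ge0 // ltW.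
have Lt : L <= t / (d / 4).
  rewrite ler_pdivlMr // mulrC -tE; apply: le_trans (expR_ge1Dx _).
  by rewrite lerDr.
pose c := (1 + tau) * L.
have c0 : 0 <= c by rewrite mulr_ge0 // ltW.
have cy0 : 0 <= c / y' by rewrite divr_ge0 // ltW.
have /andP[l1 l2] := truncn_itv cy0.
have [l lE] : exists l, l = (Num.trunc (c / y')).+1 by eexists.
have l3 : l%:R <= c / y' + 1 by rewrite lE -natr1 lerD2r.
rewrite -lE in l2.
have lpos : (0 < l)%N by rewrite lE.
have ll0 : (l0 <= l)%N.
  rewrite -(ler_nat R); apply/ltW/(le_lt_trans _ l2).
  rewrite ler_pdivlMr // /c [leRHS]mulrC -ler_pdivrMr //.
  by rewrite -ler_expR nL.
have cl : c <= l%:R * y' by rewrite -ler_pdivrMr // ltW.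
have hp := hl0 l ll0 c cl.
have {}hp : c1 / (K * t) <= 1 - fine (P (quiet l c 0)).
  apply: le_trans hp; rewrite -c1E -KE -tE -!expRD -expRN -expRD ler_expR.
  have -> : k * y + k * y * tau = k * y * (1 + tau) by ring.
  have ky0 : 0 <= k * y * (1 + tau) by rewrite !mulr_ge0 // ltW.
  have h1 := ler_wpM2r ky0 l3.
  have h2 : c / y' * (k * y * (1 + tau)) = k * (1 + tau) ^+ 3 * L.
    by rewrite /c y'E; field; rewrite gt_eqF.
  have h3 := ler_wpM2r L0 tauk.
  rewrite mulrDl h2 mul1r in h1.
  by rewrite mulrN; lra.
have /andP[g1 g2] := truncn_itv (ltW t0).
have [g gE] : exists g, g = (Num.trunc t).+1 by eexists.
rewrite -gE in g2.
have g3 : g%:R <= t + 1 by rewrite gE -natr1 lerD2r.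
have gg0 : (g0 <= g)%N by rewrite -(ler_nat R); exact: le_trans bt5 (ltW g2).
have heta : mixing_coef P g <= (K * t ^+ 4)^-1.
  apply: le_trans (hg0 g gg0) _.
  have -> : K * t ^+ 4 = t `^ xi.
    rewrite -tE -KE -expRM_natr -expRD -expRM; congr expR.
    by rewrite /xi; field; rewrite gt_eqF.
  rewrite lef_pV2 ?posrE ?powR_gt0 // ?(lt_trans t0 g2) //.
  by apply: ge0_ler_powR; rewrite ?nnegrE ?(ltW xi0) ?(ltW t0) ?(ltW g2).
have Kt2 : 0 <= K * t ^+ 2 by rewrite mulr_ge0 ?exprn_ge0 // ltW.
have /andP[N1 N2] := truncn_itv Kt2.
have [N NE] : exists N, N = Num.trunc (K * t ^+ 2) by eexists.
rewrite -NE in N1 N2.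
have hh : n%:R / expR c <= e / 3.
  rewrite -nL /c mulrDl mul1r expRD invfM mulrA divff ?gt_eqF ?expR_gt0 // mul1r.
  rewrite -[e / 3]invrK lef_pV2 ?posrE ?invr_gt0 ?expR_gt0 ?divr_gt0 //.
  by rewrite invf_div.
have Kt22 : 2 <= K * t ^+ 2.
  apply: le_trans bt6 _; rewrite expr2 mulrA ler_peMl ?(ltW t0) //.
  by rewrite -[1]mul1r; apply: ler_pM.
have hlg : l%:R + g%:R <= M * t + 3 * t.
  have h1 : c / y' <= M * t.
    rewrite -ME /c mulrAC -[leRHS]mulrA [_ * t]mulrC ler_wpM2l //.
    by rewrite divr_ge0 // ltW.
  lra.
have lg0 : 0 <= l%:R + g%:R :> R by rewrite addr_ge0.
have [Npos p0 NB fin] := block_count_estimate K t B e c1 _ _ _ M _ _ N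
  K0 c10 e0 bt1 Kt22 N1 N2 hp heta (mixing_coef_ge0 P g) hh bt2 bt3 hlg lg0 bt4 B0.
apply: (@le_trans _ _ (PP [set z | ((N * (l + g))%N%:Z < z.2 n)%R])).
  apply: (@annealed_event_le n (fun x => B * n%:R `^ a < x%:~R)
    (fun x => (N * (l + g))%N%:Z < x)) => x.
  rewrite Kta -(ltr_int R) => hx; apply: le_lt_trans hx.
  by rewrite -pmulrn natrM natrD.
apply: le_trans (annealed_right_bound P Pq PP sP hq hA N l g n c lpos Npos p0) _.
by rewrite lee_fin.
Unshelve. all: by end_near. Qed.

End right_limit.

Local Open Scope ereal_scope.

Theorem theorem2 (R : realType) (P : probability (env R) R) (J : R -> \bar R)
    (Pq : env R -> probability path_space R)
    (PP : probability (env R * path_space)%type R) :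
  stationary P -> ergodic P ->
  condA1 P -> condA2 P J -> condA3 P -> condA4 P ->
  (forall w : env R, is_quenched_law w (Pq w)) ->
  is_annealed_law P Pq PP ->
  [/\ exists2 y : R, (0 < y)%R & rate_ratio J y = kappa J,
      forall alpha : R, alpha%:E < kappa J ->
        cvg_prob_pinfty PP (scaled_walk alpha) &
      forall alpha : R, kappa J < alpha%:E ->
        cvg_prob0 PP (scaled_walk alpha)].
Proof.
move=> sP _ A1 A2 A3 A4 hq hA.
have kE := kappa_fin _ _ A2 A3 A4.
have k0 : (0 < fine (kappa J))%R by rewrite -lte_fin -kE (kappa_gt0 _ _ A2 A4).
have pownat (n : nat) (a : R) : (0 < n)%N -> (0 < (n%:R : R) `^ a)%R.
  by move=> n0; rewrite powR_gt0 // ltr0n.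
split; first exact: kappa_attained A2 A3 A4.
- move=> alpha ak M.
  rewrite kE lte_fin in ak; set k := fine (kappa J) in k0 ak.
  pose b := ((Num.max alpha 0 + k) / 2)%R.
  have mk : (Num.max alpha 0 < k)%R by rewrite gt_max ak.
  have m0 : (0 <= Num.max alpha 0)%R by rewrite le_max lexx orbT.
  have ma : (alpha <= Num.max alpha 0)%R by rewrite le_max lexx.
  have b0 : (0 < b)%R by rewrite /b; move: m0 k0 mk; clear; lra.
  have bk : (b < k)%R by rewrite /b; move: m0 k0 mk; clear; lra.
  have ab : (0 < b - alpha)%R by rewrite /b; move: m0 ma k0 mk; clear; lra.
  pose S n (x : int) := ~~ (M < n%:R `^ (- alpha) * x%:~R)%R.
  have low : (PP [set z | S n (z.2 n)] @[n --> \oo] --> 0).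
    apply: cvge0_near => [n|e e0]; first exact: measure_ge0.
    have := slow_vanishes P J Pq PP sP hq hA A2 A3 A4 b e b0 bk e0.
    move=> h; near=> n.
    have n0 : (0 < n)%N by near: n; exists 1%N.
    apply: (@le_trans _ _ (PP [set z | (z.2 n <= (Num.trunc (n%:R `^ b)%R).+1%:Z)%R]));
      last by near: n.
    apply: (@annealed_event_le R PP n (S n)
      (fun x => x <= (Num.trunc (n%:R `^ b)%R).+1%:Z)%R) => x.
    rewrite /S -leNgt powRN => hx.
    have Mb : (M <= n%:R `^ (b - alpha))%R by near: n; exact: powR_nat_ge.
    have na := pownat n alpha n0.
    have {}hx : (x%:~R <= (n%:R : R) `^ b)%R.
      have -> : b = (b - alpha + alpha)%R by rewrite subrK.
      rewrite powRD; last by rewrite pnatr_eq0 -lt0n n0 implybT.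
      by rewrite -ler_pdivrMr // mulrC; exact: le_trans hx Mb.
    have /andP[_ t2] := truncn_itv (powR_ge0 (n%:R : R) b).
    by rewrite -(ler_int R); apply/ltW/(le_lt_trans hx); rewrite -pmulrn.
  have -> : (fun n => PP [set t | (M < scaled_walk alpha n t)%R]) =
      (fun n => 1 - PP [set z | S n (z.2 n)]).
    apply/funext => n; rewrite -probability_setC; last exact: measurable_annealed_event.
    congr (PP _); apply/seteqP; split => z /=; rewrite /S /scaled_walk.
      by move=> h /negP; apply.
    by move=> /negP; rewrite negbK.
  rewrite -[X in _ --> X]sube0; apply: cvgeB => //.
  exact: cvg_cst.
- move=> alpha ka e e0; apply: cvge0_near => [n|h h0]; first exact: measure_ge0.
  have a0 : (0 < alpha)%R by rewrite -lte_fin (lt_trans _ ka) // kE lte_fin.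
  have h20 : (0 < h / 2)%R by rewrite divr_gt0.
  have rv := right_vanishes P J Pq PP sP hq hA A1 A2 A3 A4 alpha e _ ka e0 h20.
  have lv := left_vanishes P J Pq PP sP hq hA A2 A3 A4 alpha e _ a0 e0 h20.
  near=> n; have n0 : (0 < n)%N by near: n; exists 1%N.
  have na := pownat n alpha n0.
  have hr : PP [set z | (e * n%:R `^ alpha < (z.2 n)%:~R)%R] <= (h / 2)%:E.
    by near: n.
  have hl : PP [set z | (z.2 n <= - (Num.trunc (e * n%:R `^ alpha)%R)%:Z)%R] <=
      (h / 2)%:E by near: n.
  pose S (x : int) := (e < `|(n%:R : R) `^ (- alpha) * x%:~R|)%R.
  pose A (x : int) := (e * n%:R `^ alpha < x%:~R)%R.
  pose B (x : int) := (x <= - (Num.trunc (e * n%:R `^ alpha)%R)%:Z)%R.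
  apply: (@le_trans _ _ (PP [set z | (A (z.2 n)) || (B (z.2 n))])).
    apply: (@annealed_event_le R PP n S (fun x => A x || B x)) => x.
    rewrite /S powRN normrM normfV (gtr0_norm na) ltr_pdivlMl // mulrC.
    have x0 : (0 <= e * n%:R `^ alpha)%R by rewrite mulr_ge0 // ltW.
    have [xp|xn] := ltP 0%R x.
      by rewrite gtr0_norm ?ltr0z // => hx; rewrite /A hx.
    rewrite ler0_norm ?lerz0 // => hx; apply/orP; right; rewrite /B.
    have /andP[t1 _] := truncn_itv x0.
    rewrite lerNr -(ler_int R) -pmulrn mulrNz.
    exact: le_trans t1 (ltW hx).
  have -> : [set z : env R * path_space | A (z.2 n) || B (z.2 n)] =
      [set z | A (z.2 n)] `|` [set z | B (z.2 n)].
    apply/seteqP; split => z /=; first by move=> /orP.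
    by move=> ?; apply/orP.
  apply: le_trans (measureU2 _ _ _) _; try exact: measurable_annealed_event.
  have -> : h%:E = (h / 2)%:E + (h / 2)%:E by rewrite -EFinD; congr (_%:E); lra.
  exact: leeD hr hl.
Unshelve. all: by end_near. Qed.
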